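(* Let $h=\hat h\circ\tilde h:\Sigma^c\to\mathcal R$ be a random tornado tabulation hash function with $d$ derived characters, let $Q\subseteq\Sigma^c$ be a set of query keys and $f$ a selector function with query keys $Q$. If $\mu^f\le|\Sigma|/2$, then the set of derived selected keys $\tilde h(X^{f,h})$ is linearly dependent with probability at most $$\mathsf{DependenceProb}(\mu^f,d,\Sigma):=7(\mu^f)^3\left(\frac{3}{|\Sigma|}\right)^{d+1}+\frac{1}{2^{|\Sigma|/2}}.$$
   Context: Let $\Sigma=\{0,1,\dots,2^k-1\}$ be an alphabet of characters, identified with $k$-bit strings, where $\oplus$ denotes bitwise xor; throughout $|\Sigma|\ge 2^8$. Let $\mathcal R=\{0,\dots,2^r-1\}$, viewed as $r$-bit strings. A simple tabulation hash function $g:\Sigma^b\to\mathcal R'$ is $g(x_1\cdots x_b)=T_1[x_1]\oplus\cdots\oplus T_b[x_b]$ with independent fully random tables $T_i:\Sigma\to\mathcal R'$. A random tornado tabulation hash function $h:\Sigma^c\to\mathcal R$ with $d\ge1$ derived characters consists of mutually independent simple tabulation functions $\tilde h_i:\Sigma^{c+i-1}\to\Sigma$ ($i=0,\dots,d$) and $\hat h:\Sigma^{c+d}\to\mathcal R$; for $x=x_1\cdots x_c$ the derived key $\tilde h(x)=\tilde x_1\cdots\tilde x_{c+d}$ has $\tilde x_i=x_i$ for $i<c$, $\tilde x_c=x_c\oplus\tilde h_0(\tilde x_1\cdots\tilde x_{c-1})$, $\tilde x_i=\tilde h_{i-c}(\tilde x_1\cdots\tilde x_{i-1})$ for $c<i\le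 c+d$, and $h(x)=\hat h(\tilde h(x))$. A selector function with query keys $Q\subseteq\Sigma^c$ is a function $f:\Sigma^c\times\mathcal R\times\mathcal R^Q\to\{0,1\}$ with $f(q,\cdot,\cdot)=1$ for all $q\in Q$. The selected set is $X^{f,h}=\{x\in\Sigma^c: f(x,h(x),h|_Q)=1\}$. Define $p^f_x=\max_{\varphi\in\mathcal R^Q}\Pr_{r\sim\mathcal U(\mathcal R)}[f(x,r,\varphi)=1]$ and $\mu^f=\sum_{x\in\Sigma^c}p^f_x$. A set $Y\subseteq\Sigma^b$ of keys is linearly dependent if there is a nonempty $Y'\subseteq Y$ such that for every position $i\in\{1,\dots,b\}$ and every character $a\in\Sigma$, the number of $y\in Y'$ with $y_i=a$ is even; otherwise it is linearly independent. *)

(* Defs.v *)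
From mathcomp Require Import all_boot all_order all_algebra.
Set Implicit Arguments. Unset Strict Implicit. Unset Printing Implicit Defensive.
Import Order.TTheory GRing.Theory Num.Theory.

Definition bits (n : nat) := {ffun 'I_n -> bool}.
Definition bzero (n : nat) : bits n := [ffun => false].
Definition bxor (n : nat) (x y : bits n) : bits n := [ffun i => x i (+) y i].

Definition key (k b : nat) := {ffun 'I_b -> bits k}.

(* xor of table lookups T p (s_p) over the positions p < size s (and p < m);
   this is simple tabulation applied to the key s of length size s <= m *)
Definition tab (k r m : nat) (T : {ffun 'I_m -> {ffun bits k -> bits r}})
    (s : seq (bits k)) : bits r :=
  \big[@bxor r/bzero r]_(p < m | p < size s) T p (nth (bzero k) s p).

(* tables of the tornado hash: Ttil i = tables of h~_i (i = 0..d); only the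
   first c+i-1 positions of Ttil i are used; Thatp = tables of h^ *)
Definition tables (k r c d : nat) :=
  ({ffun 'I_d.+1 -> {ffun 'I_(c + d) -> {ffun bits k -> bits k}}}
   * {ffun 'I_(c + d) -> {ffun bits k -> bits r}})%type.

Definition keyn (k c : nat) (x : key k c) (j : nat) : bits k :=
  if insub j is Some i then x i else bzero k.

(* 0-indexed position j of the derived key, given the prefix s of length j *)
Definition derived_next (k c d : nat)
    (Tt : {ffun 'I_d.+1 -> {ffun 'I_(c + d) -> {ffun bits k -> bits k}}})
    (x : key k c) (j : nat) (s : seq (bits k)) : bits k :=
  if j < c.-1 then keyn x j
  else if j == c.-1 then bxor (keyn x j) (tab (Tt (inord 0)) s)
  else tab (Tt (inord (j - c).+1)) s.

Fixpoint derived_prefix (k c d : nat)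
    (Tt : {ffun 'I_d.+1 -> {ffun 'I_(c + d) -> {ffun bits k -> bits k}}})
    (x : key k c) (n : nat) : seq (bits k) :=
  match n with
  | 0 => [::]
  | n'.+1 => let s := derived_prefix Tt x n' in rcons s (derived_next Tt x n' s)
  end.

Definition derived_key (k r c d : nat) (w : tables k r c d) (x : key k c)
    : key k (c + d) :=
  [ffun j : 'I_(c + d) => nth (bzero k) (derived_prefix w.1 x (c + d)) j].

Definition tornado (k r c d : nat) (w : tables k r c d) (x : key k c) : bits r :=
  \big[@bxor r/bzero r]_(p < c + d) w.2 p (derived_key w x p).

Definition qtype (k c : nat) (Q : {set key k c}) := {x : key k c | x \in Q}.

Definition restrictQ (k r c d : nat) (Q : {set key k c}) (w : tables k r c d)
    : {ffun qtype Q -> bits r} := [ffun q => tornado w (val q)].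

Definition selector (k r c : nat) (Q : {set key k c})
    (f : key k c -> bits r -> {ffun qtype Q -> bits r} -> bool) : Prop :=
  forall q rr phi, q \in Q -> f q rr phi.

Definition selected (k r c d : nat) (Q : {set key k c})
    (f : key k c -> bits r -> {ffun qtype Q -> bits r} -> bool)
    (w : tables k r c d) : {set key k c} :=
  [set x | f x (tornado w x) (restrictQ Q w)].

Local Open Scope ring_scope.

Definition pf (k r c : nat) (Q : {set key k c})
    (f : key k c -> bits r -> {ffun qtype Q -> bits r} -> bool) (x : key k c) : rat :=
  (\max_(phi : {ffun qtype Q -> bits r}) #|[set rr : bits r | f x rr phi]|)%N%:R
  / #|{: bits r}|%:R.

Definition muf (k r c : nat) (Q : {set key k c})
    (f : key k c -> bits r -> {ffun qtype Q -> bits r} -> bool) : rat :=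
  \sum_(x : key k c) pf f x.

Definition lin_dependent (k b : nat) (Y : {set key k b}) : bool :=
  [exists Y' : {set key k b},
     [&& Y' != set0, Y' \subset Y &
      [forall i : 'I_b, forall a : bits k, ~~ odd #|[set y in Y' | y i == a]|]]].

(* probability over uniformly random (fully independent) tables *)
Definition Pr (T : finType) (E : pred T) : rat := #|[set w | E w]|%:R / #|{: T}|%:R.

(* Main.v *)
(* Write [n] for the alphabet size. If the derived selected keys are dependent, take a
   dependent set [Z] of selected keys with as few non-query keys as possible, and then as
   few keys as possible. The last two derived characters induce two perfect matchings of
   [Z]. Peeling off one edge at a time along the alternating cycles of their union gives a
   smallest family of alternating paths and cycles, on [2w] keys, whose edges at level
   [d - 1] are dependent; all but one of these edges are independent, and so are the [w - 1]
   edges at level [d]. Hence a fixed such structure has probability at most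
   [n^-(2w-2)] times the product of the selection probabilities of [2w - 1] of its keys, and
   the last key is determined by the others because it lies in a set of keys that is
   dependent at the lower levels. Each lower level costs a further factor [3 / n]: a minimal
   dependent set of [2v] keys has [(2v-1)!!] matchings, each of probability [n^-(v-1)], and
   [v = 2] dominates. Choosing the removed non-query key of [Z] as the last key keeps the
   remaining keys independent together with the queries, so their hash values are uniform.
   Structures with [w] above [73 n / 256] are cut at that size and give the term
   [2^-(n/2)]. *)

From HB Require Import structures.
Require Import Defs.
From Stdlib Require Import NArith.
From mathcomp Require Import all_boot all_order all_algebra.
From mathcomp Require Import zify ring lra.
Set Implicit Arguments. Unset Strict Implicit. Unset Printing Implicit Defensive.
Import Order.TTheory GRing.Theory Num.Theory.

(** * Linear algebra over the two-element field *)

(** Conditional probabilities are replaced by moves on the tables. Xoring a common value [t] into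
    the entries of one table picked out by a linear functional keeps the uniform distribution and
    everything computed from lower tables; if the functional is dual to one edge or key, the other
    ones under consideration are unaffected. Linear independence is what supplies such functionals,
    so every event is arranged as an independence condition on lower tables followed by equations at
    the next one. The numbers balance two demands. A structure on [2w] keys carries about
    [(mu/n)^(2w) <= 4^-w], so the weight of the lower levels may only grow in [w] at a rate below
    [4]. The circuit recursion in turn reproduces a rate [rho] roughly while [1 + 2 rho w / n] stays
    below [rho]. The rate [16/5] meets both demands for [w <= 2n/7], with room for polynomial
    factors. For the structures that are cut, [4^-w] alone must reach [2^-(n/2)], which asks for [w]
    somewhat above [n/4]; the cut at [73/256] lies just under [2/7]. *)

Lemma bxorE n (x y : bits n) i : bxor x y i = x i (+) y i.
Proof. by rewrite ffunE. Qed.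

Lemma bxorA n : associative (@bxor n).
Proof. by move=> x y z; apply/ffunP=> i; rewrite !bxorE addbA. Qed.

Lemma bxorC n : commutative (@bxor n).
Proof. by move=> x y; apply/ffunP=> i; rewrite !bxorE addbC. Qed.

Lemma bxor0b n : left_id (bzero n) (@bxor n).
Proof. by move=> x; apply/ffunP=> i; rewrite bxorE ffunE. Qed.

HB.instance Definition _ n :=
  Monoid.isComLaw.Build (bits n) (bzero n) (@bxor n) (@bxorA n) (@bxorC n) (@bxor0b n).

Lemma bxorb0 n : right_id (bzero n) (@bxor n).
Proof. by move=> x; rewrite bxorC bxor0b. Qed.

Lemma bxorbb n (x : bits n) : bxor x x = bzero n.
Proof. by apply/ffunP=> i; rewrite bxorE addbb ffunE. Qed.

Lemma bxorK n (y : bits n) : involutive (fun x : bits n => bxor x y).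
Proof. by move=> x; rewrite -bxorA bxorbb bxorb0. Qed.

Lemma bxor_eq0 n (x y : bits n) : (bxor x y == bzero n) = (x == y).
Proof.
apply/eqP/eqP=> [h|->]; last exact: bxorbb.
by rewrite -(bxorK y x) h bxor0b.
Qed.

Lemma big_bxorE n (I : Type) (s : seq I) (P : pred I) (F : I -> bits n) i :
  (\big[@bxor n/bzero n]_(j <- s | P j) F j) i = \big[addb/false]_(j <- s | P j) F j i.
Proof. by apply: (big_morph (fun x : bits n => x i)) => [x y|]; rewrite ffunE. Qed.

Lemma big_addb_const (I : finType) (A : pred I) b :
  \big[addb/false]_(x in A) b = odd #|A| && b.
Proof. by rewrite big_const; elim: #|A| => //= m ->; case: b (odd m) => [] []. Qed.

Lemma odd_card_sum (I : finType) (A : pred I) : odd #|A| = \big[addb/false]_(x in A) true.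
Proof. by rewrite big_addb_const andbT. Qed.

Lemma odd_card_setI (I : finType) (V : {set I}) (P : pred I) :
  odd #|[set x in V | P x]| = \big[addb/false]_(x in V) P x.
Proof.
rewrite odd_card_sum big_mkcond [RHS]big_mkcond /=; apply: eq_bigr => x _.
by rewrite inE; case: (x \in V) (P x) => [] [].
Qed.

Definition dot (P : finType) (D v : P -> bool) := \big[addb/false]_p (D p && v p).

Lemma dotDl (P : finType) (D E v : P -> bool) :
  dot (fun p => D p (+) E p) v = dot D v (+) dot E v.
Proof. by rewrite -big_split; apply: eq_bigr => p _; rewrite andb_addl. Qed.

Lemma dotDr (P : finType) (D u v : P -> bool) :
  dot D (fun p => u p (+) v p) = dot D u (+) dot D v.
Proof. by rewrite -big_split; apply: eq_bigr => p _; rewrite andb_addr. Qed.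

(* The Fredholm alternative over the field with two elements. *)
Lemma dual_or_span (I P : finType) (r : I -> P -> bool) (J : {set I}) (r0 : P -> bool) :
  (exists2 U : {set I}, U \subset J & forall p, r0 p = \big[addb/false]_(x in U) r x p)
  \/ (exists D : {ffun P -> bool}, dot D r0 /\ forall x, x \in J -> ~~ dot D (r x)).
Proof.
elim: {J}#|J| {-2}J (erefl #|J|) r0 => [|m IH] J cJ r0.
  have [/existsP[p rp]|] := boolP [exists p, r0 p].
    right; exists [ffun q => q == p]; split.
      by rewrite /dot (bigD1 p) //= ffunE eqxx rp big1 // => q /negPf qp; rewrite ffunE qp.
    by move=> x; rewrite (cards0_eq cJ) inE.
  rewrite negb_exists => /forallP h; left; exists set0; first exact: sub0set.
  by move=> p; rewrite big_set0; apply/negbTE.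
have /card_gt0P[j jJ] : 0 < #|J| by rewrite cJ.
have cJ' : #|J :\ j| = m by move: cJ; rewrite (cardsD1 j) jJ => -[].
have sub x : x \in J -> x = j \/ x \in J :\ j.
  by move=> xJ; case: (eqVneq x j) => [->|xj]; [left|right; rewrite !inE xj].
have [[U sU hU]|[D [D0 DJ]]] := IH _ cJ' r0.
  by left; exists U => //; apply: subset_trans sU (subsetDl _ _).
have [Dj|Dj] := boolP (dot D (r j)); last first.
  by right; exists D; split=> // x /sub[->|/DJ].
(* Here [D] takes the value 1 on both [r0] and [r j]. A second functional for [r0 + r j] either
   vanishes on [r j] and serves itself, or its sum with [D] does. *)
have [[U sU hU]|[D' [D'0 D'J]]] := IH _ cJ' (fun p => r0 p (+) r j p).
  left; exists (j |: U).
    by rewrite subUset sub1set jJ (subset_trans sU (subsetDl _ _)).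
  move=> p; rewrite big_setU1 /=; last by apply/negP=> /(subsetP sU); rewrite !inE eqxx.
  by rewrite -hU; case: (r j p) (r0 p) => [] [].
rewrite dotDr in D'0.
have [D'j|D'j] := boolP (dot D' (r j)); last first.
  right; exists D'; split=> [|x /sub[->|/D'J] //].
  by move: D'0 D'j; case: (dot D' r0) (dot D' (r j)) => [] [].
right; exists [ffun p => D p (+) D' p].
have E v : dot [ffun p => D p (+) D' p] v = dot D v (+) dot D' v.
  by rewrite -dotDl; apply: eq_bigr => p _; rewrite ffunE.
split=> [|x xJ]; rewrite E; first by move: D0 D'0 D'j; case: (dot D r0) (dot D' r0) (dot D' (r j)) => [] [] [].
case: (sub x xJ) => [->|xJ']; first by rewrite Dj D'j.
by rewrite (negbTE (DJ x xJ')) (negbTE (D'J x xJ')).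
Qed.

(** Double counting of pairs [(t, w)]: each [Phi t] permutes the outcomes of [E], so the frequency
    of [C] within [E] is an average over orbits. In effect [M / #|T|] bounds the conditional
    probability of [C] given [E]. *)
Lemma averaging (Om T : finType) (Phi : T -> Om -> Om) (E C : pred Om) (M : nat) :
  (forall t, injective (Phi t)) -> (forall t w, E (Phi t w) = E w) ->
  (forall w, E w -> #|[set t | C (Phi t w)]| <= M) ->
  #|[set w | E w && C w]| * #|T| <= #|[set w | E w]| * M.
Proof.
move=> injP invE leM.
have -> : #|[set w | E w && C w]| * #|T| = \sum_(t : T) #|[set w | E w && C (Phi t w)]|.
  rewrite mulnC -sum_nat_const; apply: eq_bigr => t _.
  rewrite -(card_preimset [set w | E w && C w] (injP t)); apply: eq_card => w.
  by rewrite !inE invE.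
have -> : \sum_(t : T) #|[set w | E w && C (Phi t w)]| =
    \sum_(w in [set w | E w]) #|[set t | C (Phi t w)]|.
  under eq_bigr do rewrite -sum1_card.
  under [RHS]eq_bigr do rewrite -sum1_card.
  rewrite (exchange_big_dep (mem [set w | E w])) /=.
    apply: eq_bigr => w; rewrite inE => Ew; apply: eq_bigl => t.
    by rewrite !inE Ew.
  by move=> t w _; rewrite !inE => /andP[].
rewrite -sum_nat_const; apply: leq_sum => w; rewrite inE; exact: leM.
Qed.

(** * Matchings and alternating paths *)

(** The double factorial [(2m-1)!!], the number of perfect matchings of [2m] points. *)
Definition dfact m := \prod_(j < m) j.*2.+1.

Lemma dfactS m : dfact m.+1 = dfact m * m.*2.+1.
Proof. by rewrite /dfact big_ord_recr. Qed.

Section Matchings.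
Variable K : finType.
Implicit Types (V W S C : {set K}) (a b : K -> K) (x y z : K).

(** A perfect matching of [V], encoded as a fixed-point-free involution. *)
Definition fpf V a := [forall x in V, [&& a x \in V, a x != x & a (a x) == x]].
(** Being the identity off [V] makes each matching one finite function, so that matchings can be
    counted and summed over. *)
Definition Inv V : {set {ffun K -> K}} :=
  [set a : {ffun K -> K} | fpf V a && [forall x, (x \notin V) ==> (a x == x)]].
Definition eclosed a V := [forall x in V, a x \in V].
Definition restr a V : {ffun K -> K} := [ffun x => if x \in V then a x else x].

Lemma fpfP V a x : fpf V a -> x \in V -> [/\ a x \in V, a x != x & a (a x) = x].
Proof. by move=> /forall_inP h /h /and3P[? ? /eqP]. Qed.

Lemma closedP V a x : eclosed a V -> x \in V -> a x \in V.
Proof. by move=> /forall_inP h /h. Qed.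

Lemma fpf_inj V a x y : fpf V a -> x \in V -> y \in V -> a x = a y -> x = y.
Proof. by move=> h xV yV e; case: (fpfP h xV) => _ _ <-; case: (fpfP h yV) => _ _ <-; rewrite e. Qed.

Lemma fpf_closed V a : fpf V a -> eclosed a V.
Proof. by move=> h; apply/forall_inP => x xV; case: (fpfP h xV). Qed.

Lemma fpf_sub V W a : fpf V a -> W \subset V -> eclosed a W -> fpf W a.
Proof.
move=> h sWV cW; apply/forall_inP => x xW; rewrite (closedP cW xW) /=.
by case: (fpfP h (subsetP sWV _ xW)) => _ -> ->; rewrite eqxx.
Qed.

Lemma restr_Inv V a : fpf V a -> restr a V \in Inv V.
Proof.
move=> h; rewrite inE; apply/andP; split; last first.
  by apply/forallP => x; apply/implyP => /negPf xV; rewrite ffunE xV.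
by apply/forall_inP => x xV; case: (fpfP h xV) => axV axx e; rewrite !ffunE xV axV axx e /=.
Qed.

Lemma restrE V a x : x \in V -> restr a V x = a x.
Proof. by move=> xV; rewrite ffunE xV. Qed.

Lemma Inv_fpf V (a : {ffun K -> K}) : a \in Inv V -> fpf V a.
Proof. by rewrite inE => /andP[]. Qed.

Lemma Inv_out V (a : {ffun K -> K}) x : a \in Inv V -> x \notin V -> a x = x.
Proof. by rewrite inE => /andP[_ /forallP/(_ x)/implyP h] /h/eqP. Qed.

Lemma closedD V W a : fpf V a -> W \subset V -> eclosed a W -> eclosed a (V :\: W).
Proof.
move=> h sWV cW; apply/forall_inP => x; rewrite !inE => /andP[xW xV].
case: (fpfP h xV) => -> _ e; rewrite andbT; apply: contra xW => /(closedP cW).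
by rewrite e.
Qed.

Lemma closed_pair V a x : fpf V a -> x \in V -> eclosed a [set x; a x].
Proof.
move=> h xV; case: (fpfP h xV) => _ _ e.
by apply/forall_inP => y; rewrite !inE => /orP[] /eqP->; rewrite ?e eqxx ?orbT.
Qed.

Lemma sub_pair V a x : fpf V a -> x \in V -> [set x; a x] \subset V.
Proof. by move=> h xV; case: (fpfP h xV) => axV _ _; rewrite subUset !sub1set xV axV. Qed.

Lemma card_fpf_pair V a x : fpf V a -> x \in V -> #|V| = #|V :\: [set x; a x]|.+2.
Proof.
move=> h xV; rewrite -(cardsID [set x; a x] V) (setIidPr (sub_pair h xV)) cards2.
by case: (fpfP h xV) => _ axx _; rewrite eq_sym axx.
Qed.

Lemma card_Inv m V : #|V| = m.*2 -> #|Inv V| <= dfact m.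
Proof.
elim: m V => [|m IH] V cV.
  rewrite /dfact big_ord0 -(cards1 (restr id V)).
  apply: subset_leq_card; apply/subsetP => a; rewrite !inE => /andP[_ /forallP h].
  apply/eqP/ffunP => x; rewrite ffunE if_same.
  by have /implyP := h x; rewrite (cards0_eq cV) inE => /(_ isT)/eqP.
have /card_gt0P[x xV] : 0 < #|V| by rewrite cV.
pose F y := [set a in Inv V | a x == y].
have sub : Inv V \subset \bigcup_(y in V :\ x) F y.
  apply/subsetP => a aV; case: (fpfP (Inv_fpf aV) xV) => axV axx _.
  by apply/bigcupP; exists (a x); rewrite !inE ?axx // eqxx andbT; rewrite inE in aV.
apply: leq_trans (subset_leq_card sub) _.
have bound y : y \in V :\ x -> #|F y| <= dfact m.
  rewrite !inE => /andP[yx yV].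
  have cV' : #|V :\: [set x; y]| = m.*2.
    have := cardsID [set x; y] V; rewrite (setIidPr _) ?subUset ?sub1set ?xV ?yV //.
    by rewrite cards2 eq_sym yx cV doubleS => -[].
  apply: leq_trans (IH _ cV').
  have FP (a : {ffun K -> K}) : a \in F y -> a \in Inv V /\ a x = y by rewrite inE => /andP[? /eqP].
  pose G (a : {ffun K -> K}) := restr a (V :\: [set x; y]).
  have -> : #|F y| = #|G @: F y|.
    rewrite card_in_imset // => a b /FP[aV ax] /FP[bV bx] /ffunP eG; apply/ffunP => u.
    have := eG u; rewrite !ffunE !inE negb_or.
    case: (boolP (u \in V)) => uV; rewrite ?andbT ?andbF; last first.
      by rewrite (Inv_out aV uV) (Inv_out bV uV).
    case: eqP => [->|_] /=; first by rewrite ax bx.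
    case: eqP => [-> _|//].
    case: (fpfP (Inv_fpf aV) xV) => _ _; case: (fpfP (Inv_fpf bV) xV) => _ _.
    by rewrite ax bx => -> ->.
  apply: subset_leq_card; apply/subsetP => _ /imsetP[a /FP[aV ax] ->].
  have fa := Inv_fpf aV; apply: restr_Inv.
  rewrite -ax; apply: (fpf_sub fa); first exact: subsetDl.
  by apply: (closedD fa); [apply: sub_pair fa xV|apply: closed_pair fa xV].
apply: leq_trans (_ : \sum_(y in V :\ x) #|F y| <= _).
  elim/big_rec2: _ => [|y s A _ le]; first by rewrite cards0.
  by apply: leq_trans (leq_card_setU _ _) _; rewrite leq_add2l.
apply: (@leq_trans (\sum_(y in V :\ x) dfact m)); first by apply: leq_sum.
rewrite sum_nat_const.
by move: cV; rewrite (cardsD1 x) xV add1n dfactS mulnC doubleS => -[->].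
Qed.

(** Even fibres can be paired off two elements at a time. This turns an even character count into a
    matching along which the character is constant. *)
Lemma pairing (T : eqType) (f : K -> T) V :
  (forall t, ~~ odd #|[set x in V | f x == t]|) ->
  exists2 a, a \in Inv V & forall x, x \in V -> f (a x) = f x.
Proof.
elim: {V}_.+1 {-2}V (ltnSn #|V|) => // m IH V ltV ev.
case: (set_0Vmem V) => [V0|[x xV]].
  exists [ffun x => x]; last by move=> x; rewrite V0 inE.
  rewrite inE; apply/andP; split; first by apply/forall_inP => x; rewrite V0 inE.
  by apply/forallP => x; rewrite ffunE eqxx implybT.
pose A := [set u in V | f u == f x].
have xA : x \in A by rewrite !inE xV eqxx.
have : A :\ x != set0.
  apply: contra (ev (f x)) => /eqP e; have := cardsD1 x A; rewrite xA e cards0.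
  by rewrite -/A => ->.
case/set0Pn => y; rewrite !inE => /and3P[yx yV /eqP fyx].
pose V' := V :\ x :\ y.
have cV' : #|V| = #|V'|.+2.
  by rewrite (cardsD1 x) xV (cardsD1 y) !inE yx yV.
have ev' t : ~~ odd #|[set u in V' | f u == t]|.
  case: (eqVneq (f x) t) => [fxt|fxt]; last first.
    rewrite (_ : [set u in V' | _] = [set u in V | f u == t]) //.
    apply/setP => u; rewrite !inE; case: (eqVneq u y) => [->|] /=.
      by rewrite fyx (negbTE fxt) andbF.
    by case: (eqVneq u x) => [->|] //=; rewrite (negbTE fxt) andbF.
  have := ev t; rewrite (cardsD1 x) (cardsD1 y) !inE yx yV xV fyx fxt eqxx /= negbK.
  rewrite (_ : [set u in V' | _] = [set u in V | f u == t] :\ x :\ y) //.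
  by apply/setP => u; rewrite !inE -!andbA.
have [|a aV' fa] := IH V' _ ev'; first by move: ltV; rewrite cV'; apply: ltnW.
have nx : x \in V' = false by rewrite !inE eqxx andbF.
have ny : y \in V' = false by rewrite !inE eqxx.
pose b := [ffun u => if u == x then y else if u == y then x else a u].
have bx : b x = y by rewrite ffunE eqxx.
have by_ : b y = x by rewrite ffunE (negbTE yx) eqxx.
have bV u : u \in V' -> b u = a u.
  by rewrite !inE => /and3P[/negPf uy /negPf ux _]; rewrite ffunE ux uy.
have VE u : u \in V -> [\/ u = x, u = y | u \in V'].
  move=> uV; case: (eqVneq u x) => [->|ux]; first by constructor 1.
  by case: (eqVneq u y) => [->|uy]; [constructor 2|constructor 3; rewrite !inE uy ux].
exists b.
  rewrite inE; apply/andP; split.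
    apply/forall_inP => u /VE[->|->|uV'].
    - by rewrite bx by_ yV yx eqxx.
    - by rewrite by_ bx xV eq_sym yx eqxx.
    case: (fpfP (Inv_fpf aV') uV') => auV' auu e.
    rewrite bV // bV // auu e eqxx !andbT.
    by move: auV'; rewrite !inE => /and3P[].
  apply/forallP => u; apply/implyP => uV; rewrite ffunE.
  case: (eqVneq u x) uV => [->|_ uV]; first by rewrite xV.
  case: (eqVneq u y) uV => [->|_ uV]; first by rewrite yV.
  have nu : u \notin V' by rewrite !inE (negbTE uV) !andbF.
  by move: aV'; rewrite inE => /andP[_ /forallP/(_ u)]; rewrite nu.
move=> u /VE[->|->|uV']; rewrite ?bx ?by_ ?fyx // bV //; exact: fa.
Qed.

(** One end of each edge; the enumeration order only breaks the symmetry. *)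
Definition halfset V a := [set x in V | enum_rank x < enum_rank (a x)].

Lemma half_sub V a : halfset V a \subset V.
Proof. by apply/subsetP => x; rewrite inE => /andP[]. Qed.

Lemma half_inj V a : fpf V a -> {in halfset V a &, injective a}.
Proof.
by move=> h x y /(subsetP (half_sub _ _)) xV /(subsetP (half_sub _ _)); apply: fpf_inj h xV.
Qed.

Lemma half_compl V a : fpf V a -> V :\: halfset V a = a @: halfset V a.
Proof.
move=> h; apply/setP => x; rewrite !inE.
apply/andP/imsetP => [[nx xV]|[y + ->]].
  case: (fpfP h xV) => axV axx e; exists (a x); rewrite ?e // inE axV e /=.
  move: nx; rewrite xV /= -leqNgt leq_eqVlt => /orP[|//].
  by rewrite (inj_eq val_inj) (inj_eq enum_rank_inj) (negbTE axx).
rewrite inE => /andP[yV lt]; case: (fpfP h yV) => ayV _ e.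
by rewrite ayV e -leqNgt ltnW.
Qed.

Lemma card_half V a : fpf V a -> #|V| = #|halfset V a|.*2.
Proof.
move=> h; rewrite -(cardsID (halfset V a) V) (setIidPr (half_sub _ _)).
by rewrite half_compl // card_in_imset ?addnn //; apply: half_inj.
Qed.

Lemma addb_fpf V a (F : K -> bool) : fpf V a -> (forall x, x \in V -> F (a x) = F x) ->
  \big[addb/false]_(x in V) F x = false.
Proof.
move=> h e; rewrite (big_setID (halfset V a)) /= (setIidPr (half_sub _ _)) half_compl //.
rewrite big_imset /=; last exact: half_inj.
rewrite -big_split big1 // => x /(subsetP (half_sub _ _)) xV.
by rewrite /= e // addbb.
Qed.

(** A union of edges is recovered from its trace on [halfset V a]. *)
Lemma card_closed V a : fpf V a ->
  #|[set W : {set K} | (W \subset V) && eclosed a W]| <= 2 ^ #|halfset V a|.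
Proof.
move=> h; rewrite -card_powerset.
have injI : {in [set W : {set K} | (W \subset V) && eclosed a W] &,
    injective (fun W => W :&: halfset V a)}.
  have aux W W' : (W \subset V) && eclosed a W -> (W' \subset V) && eclosed a W' ->
      W :&: halfset V a = W' :&: halfset V a -> W \subset W'.
    move=> /andP[sW cW] /andP[sW' cW'] /setP e; apply/subsetP => x xW.
    have xV := subsetP sW _ xW; case: (fpfP h xV) => axV axx eax.
    case: (ltngtP (enum_rank x) (enum_rank (a x))) => cmp.
    - by have := e x; rewrite !inE xW xV cmp /= andbT.
    - have := e (a x); rewrite !inE (closedP cW xW) axV eax cmp /= andbT => /esym.
      by move/(closedP cW'); rewrite eax.
    - by move/val_inj/enum_rank_inj: cmp axx => <-; rewrite eqxx.
  move=> W W'; rewrite !inE => hW hW' e; apply/eqP.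
  by rewrite eqEsubset (aux W W') // (aux W' W).
rewrite -(card_in_imset injI); apply: subset_leq_card; apply/subsetP => _ /imsetP[W _ ->].
by rewrite inE subsetIr.
Qed.

(** With [Z] the vanishing of a sum of rows, this is linear independence of the edges of [a], the
    vector of an edge being the sum of the rows of its two ends. *)
Definition ind (Z : pred {set K}) a V :=
  [forall W : {set K}, [&& W \subset V, eclosed a W & W != set0] ==> ~~ Z W].
Definition circuit (Z : pred {set K}) V :=
  [&& V != set0, Z V & [forall W : {set K}, [&& W \subset V, W != set0 & Z W] ==> (W == V)]].

Lemma indP Z a V W : ind Z a V -> W \subset V -> eclosed a W -> W != set0 -> ~~ Z W.
Proof. by move=> /forallP/(_ W)/implyP h s c n; apply: h; rewrite s c n. Qed.

Lemma ind_sub Z a V W : ind Z a V -> W \subset V -> ind Z a W.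
Proof.
move=> h s; apply/forallP => U; apply/implyP => /and3P[sU cU nU].
exact: indP h (subset_trans sU s) cU nU.
Qed.

Lemma circuitP Z V W : circuit Z V -> W \subset V -> W != set0 -> Z W -> W = V.
Proof. by move=> /and3P[_ _ /forallP/(_ W)/implyP h] s n z; apply/eqP/h; rewrite s n z. Qed.

(** If a smaller dependent subset [W] misses [x], its complement in [V] is again dependent and
    contains [x], so the descent never loses [x]. *)
Lemma circuit_through (Z : pred {set K}) V x :
  (forall V W, Z V -> Z W -> W \subset V -> Z (V :\: W)) ->
  Z V -> x \in V -> exists C, [/\ circuit Z C, x \in C & C \subset V].
Proof.
move=> ZD; elim: {V}_.+1 {-2}V (ltnSn #|V|) => // m IH V ltV zV xV.
have [cV|] := boolP (circuit Z V); first by exists V.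
rewrite /circuit zV (_ : V != set0) /=; last by apply/set0Pn; exists x.
rewrite negb_forall => /existsP[W]; rewrite negb_imply => /andP[/and3P[sW nW zW] neW].
have pW : W \proper V by rewrite properEneq neW sW.
case: (boolP (x \in W)) => xW.
  have [|C [cC xC sC]] := IH W _ zW xW; first by rewrite (leq_trans (proper_card pW)).
  by exists C; split=> //; apply: subset_trans sC sW.
have [|||C [cC xC sC]] := IH (V :\: W).
- apply: (@leq_trans #|V|); last by rewrite -ltnS.
  apply: proper_card; rewrite properE subsetDl /=.
  case/set0Pn: nW => y yW; apply/subsetPn; exists y; first exact: (subsetP sW).
  by rewrite inE yW.
- exact: ZD.
- by rewrite inE xW.
by exists C; split=> //; apply: subset_trans sC (subsetDl _ _).
Qed.

(* [S] is a union of alternating cycles of [a] and [b] and of one alternating path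
   with ends [x] and [y]; the point [z] may only occur as the end [x]. *)
Definition good (Z : {set K}) a b z S x y :=
  [&& S \subset Z, eclosed a S, x \in S, y \in S, x != y,
      eclosed b (S :\: [set x; y]) & (z \in S) ==> (z == x)].

(** Dropping the single edge between [z] and [b z] opens the alternating cycle through [z] into a
    path. *)
Lemma good_start Z a b z : fpf Z a -> fpf Z b -> z \in Z -> good Z a b z Z z (b z).
Proof.
move=> ha hb zZ; case: (fpfP hb zZ) => bzZ bzz _.
rewrite /good subxx fpf_closed // zZ bzZ eq_sym bzz eqxx /=.
by rewrite (closedD hb) // ?sub_pair // (closed_pair hb).
Qed.

(** The edge of [a] at the end [x] is removed together with both its ends, and the path then begins
    at [b (a x)]. If [z] is present it equals [x], so it disappears with the first step. *)
Lemma good_step Z a b z S x y : fpf Z a -> fpf Z b -> good Z a b z S x y -> 2 < #|S| ->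
  exists x' y', good Z a b z (S :\: [set x; a x]) x' y'.
Proof.
move=> ha hb /and5P[sS cS xS yS /and3P[xy cb zS]] gtS.
have haS := fpf_sub ha sS cS.
have [axS axx aax] := fpfP haS xS.
set S' := S :\: _.
have sS' : S' \subset Z := subset_trans (subsetDl _ _) sS.
have cS' : eclosed a S' by rewrite (closedD haS) // ?sub_pair // (closed_pair haS).
have zS' : z \notin S'.
  by apply/negP; rewrite !inE => /andP[+ zS2]; move: zS; rewrite zS2 /= => ->.
(* The path was this one edge: only cycles remain, and one of them is opened at an arbitrary key
   [u]. *)
case: (eqVneq (a x) y) => [axy|axy].
  have cardS' : #|S| = #|S'|.+2 := card_fpf_pair haS xS.
  have /card_gt0P[u uS'] : 0 < #|S'| by move: gtS; rewrite cardS'.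
  have hbS' : fpf S' b by apply: (fpf_sub hb) => //; rewrite /S' axy.
  have [buS' buu _] := fpfP hbS' uS'.
  exists u, (b u); rewrite /good sS' cS' uS' buS' eq_sym buu (negbTE zS') /= andbT.
  by rewrite (closedD hbS') // ?sub_pair // (closed_pair hbS').
have hbT : fpf (S :\: [set x; y]) b.
  by apply: (fpf_sub hb) => //; apply: subset_trans sS; apply: subsetDl.
have axT : a x \in S :\: [set x; y] by rewrite !inE (negbTE axx) (negbTE axy).
have [uT uu bu] := fpfP hbT axT.
move: (uT); rewrite !inE negb_or => /andP[/andP[ux uy] uS].
exists (b (a x)), y; rewrite /good sS' cS' (negbTE zS') uy /= andbT.
rewrite !inE negb_or ux uu uS negb_or eq_sym xy eq_sym axy yS /=.
have -> : S' :\: [set b (a x); y] = (S :\: [set x; y]) :\: [set a x; b (a x)].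
  apply/setP => v; rewrite !inE.
  by case: (v == x) (v == y) (v == a x) (v == b (a x)) (v \in S) => [] [] [] [] [].
by rewrite (closedD hbT) // ?sub_pair // (closed_pair hbT).
Qed.

Lemma card_good Z a b z S x y : fpf Z a -> good Z a b z S x y -> #|S| = #|halfset S a|.*2.
Proof. by move=> ha /and5P[sS cS _ _ _]; apply: card_half; apply: fpf_sub ha sS cS. Qed.

(** Each step removes exactly one edge of [a], so every positive even size up to [#|S|] is reached.
    The final inclusion lets independence of the remaining edges be inherited. *)
Lemma good_descend Z a b z S x y m : fpf Z a -> fpf Z b -> good Z a b z S x y ->
  0 < m -> m.*2 <= #|S| ->
  exists S' x' y', [/\ good Z a b z S' x' y', #|S'| = m.*2 &
    S' :\: [set x'; a x'] \subset S :\: [set x; a x]].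
Proof.
move=> ha hb; elim: {S}_.+1 {-2}S (ltnSn #|S|) x y => // j IH S ltS x y g m0 leS.
case: (eqVneq #|S| m.*2) => [e|ne]; first by exists S, x, y.
have lt2 : m.*2.+1 < #|S|.
  have := card_good ha g; move: (#|halfset S a|) ne leS => h ne leS cS.
  by move: ne leS; rewrite cS; clear; lia.
have [|x' [y' g']] := good_step ha hb g; first by apply: leq_trans lt2; rewrite !ltnS double_gt0.
have /and5P[sS clS xS _ _] := g.
have cS' := card_fpf_pair (fpf_sub ha sS clS) xS.
have [|||S2 [x2 [y2 [g2 c2 s2]]]] := IH (S :\: [set x; a x]) _ x' y' g' => //.
- by move: ltS; rewrite cS'; apply: ltnW.
- by move: lt2; rewrite cS'.
by exists S2, x2, y2; split=> //; apply: subset_trans s2 (subsetDl _ _).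
Qed.

End Matchings.

(** * Derived characters *)

Section DerivedCharacters.
Variables (k c d : nat).
Hypothesis c_gt0 : 0 < c.
Local Notation tilde := {ffun 'I_d.+1 -> {ffun 'I_(c + d) -> {ffun bits k -> bits k}}}.
Local Notation key := (key k c).
Implicit Types (T : tilde) (x y : key) (V W : {set key}) (a : key -> key).

Definition ch T x p : bits k := derived_next T x p (derived_prefix T x p).

Lemma derived_prefixE T x l : derived_prefix T x l = mkseq (ch T x) l.
Proof. by elim: l => // l IH; rewrite mkseqS /= IH /ch IH. Qed.

Lemma tab_mkseq r m (U : {ffun 'I_m -> {ffun bits k -> bits r}}) (f : nat -> bits k) l :
  tab U (mkseq f l) = \big[@bxor r/bzero r]_(p < m | p < l) U p (f p).
Proof.
rewrite /tab size_mkseq; apply: eq_bigr => p pl.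
by rewrite nth_mkseq.
Qed.

Lemma ch_low T x p : p < c.-1 -> ch T x p = keyn x p.
Proof. by move=> h; rewrite /ch /derived_next h. Qed.

(* Level [i] is position [c.-1 + i], the character computed with the table [T i]. *)
Definition offset i x : bits k := if i is 0 then keyn x c.-1 else bzero k.

Lemma ch_level T x i : i <= d ->
  ch T x (c.-1 + i) = bxor (offset i x)
    (\big[@bxor k/bzero k]_(p < c + d | p < c.-1 + i) T (inord i) p (ch T x p)).
Proof.
move=> id; rewrite {1}/ch /derived_next derived_prefixE -(tab_mkseq (T (inord i)) (ch T x)).
rewrite [_ + i < _]ltnNge leq_addr /=; case: i id => [|i] id; first by rewrite addn0 eqxx.
rewrite -[X in _ == X]addn0 eqn_add2l /= bxor0b.
by rewrite (_ : (c.-1 + i.+1 - c).+1 = i.+1) //; lia.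
Qed.

Definition agree i T T' := forall j : 'I_d.+1, j < i -> T j = T' j.

Lemma ch_agree T T' i x p : agree i T T' -> i <= d.+1 -> p < c.-1 + i -> ch T x p = ch T' x p.
Proof.
move=> h id; elim/ltn_ind: p => p IH pi.
case: (ltnP p c.-1) => pc; first by rewrite !ch_low.
have [j e] : exists j, p = c.-1 + j by exists (p - c.-1); rewrite subnKC.
have ji : j < i by move: pi; rewrite e ltn_add2l.
have jd : j <= d by rewrite -ltnS (leq_trans ji).
rewrite e !ch_level //; congr bxor; apply: eq_bigr => q; rewrite -e => qj.
by rewrite h ?inordK // IH // (ltn_trans qj).
Qed.

(** The indicator vector, over position-character pairs, of the first [l] derived characters of [x].
    Linear dependence of keys is a vanishing sum of these rows over the two-element field. *)
Definition crow T l x (pa : 'I_(c + d) * bits k) := (pa.1 < l) && (ch T x pa.1 == pa.2).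
Definition zero T l V := [forall pa, ~~ \big[addb/false]_(x in V) crow T l x pa].

Lemma zeroP T l V pa : zero T l V -> \big[addb/false]_(x in V) crow T l x pa = false.
Proof. by move=> /forallP/(_ pa)/negbTE. Qed.

Lemma crow_agree T T' i x : agree i T T' -> i <= d.+1 -> crow T (c.-1 + i) x =1 crow T' (c.-1 + i) x.
Proof. by move=> h id [p b]; rewrite /crow /=; case: ltnP => //= pi; rewrite (ch_agree x h id pi). Qed.

Lemma zero_agree T T' i : agree i T T' -> i <= d.+1 -> zero T (c.-1 + i) =1 zero T' (c.-1 + i).
Proof.
move=> h id V; apply: eq_forallb => pa; congr negb; apply: eq_bigr => x _.
exact: crow_agree.
Qed.

Lemma zero_leq T l l' V : l' <= l -> zero T l V -> zero T l' V.
Proof.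
move=> ll z; apply/forallP => -[p b]; case: (ltnP p l') => pl; last first.
  by rewrite big1 // => x _; rewrite /crow /= ltnNge pl.
have /= := zeroP (p, b) z; rewrite /crow /= pl (leq_trans pl ll) /= => ->//.
Qed.

Lemma zeroD T l V W : zero T l V -> zero T l W -> W \subset V -> zero T l (V :\: W).
Proof.
move=> zV zW sWV; apply/forallP => pa; have := zeroP pa zV.
by rewrite (big_setID W) /= (setIidPr sWV) (zeroP pa zW) /= => ->.
Qed.

(** A Boolean function of one character is a sum of indicators of characters, and each of these sums
    to zero over [V]. *)
Lemma zero_addb T l V (p : 'I_(c + d)) (g : bits k -> bool) : zero T l V -> p < l ->
  \big[addb/false]_(x in V) g (ch T x p) = false.
Proof.
move=> z pl.
have -> : \big[addb/false]_(x in V) g (ch T x p) =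
    \big[addb/false]_(x in V) \big[addb/false]_b (g b && crow T l x (p, b)).
  apply: eq_bigr => x _; rewrite (bigD1 (ch T x p)) //= /crow /= pl eqxx !andbT.
  by rewrite big1 ?addbF // => b /negPf nb; rewrite /= [_ == b]eq_sym nb andbF.
rewrite exchange_big big1 //= => b _.
case: (g b); last by rewrite big1.
exact: zeroP z.
Qed.

Lemma zero_bxor r T l V (p : 'I_(c + d)) (g : bits k -> bits r) : zero T l V -> p < l ->
  \big[@bxor r/bzero r]_(x in V) g (ch T x p) = bzero r.
Proof.
move=> z pl; apply/ffunP => j; rewrite big_bxorE ffunE.
exact: (zero_addb (fun b => g b j) z pl).
Qed.

Definition matched T i a V := [forall x in V, ch T (a x) (c.-1 + i) == ch T x (c.-1 + i)].

Lemma matchedP T i a V x : matched T i a V -> x \in V ->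
  ch T (a x) (c.-1 + i) = ch T x (c.-1 + i).
Proof. by move=> /forall_inP h /h/eqP. Qed.

Lemma matched_sub T i a V W : matched T i a V -> W \subset V -> matched T i a W.
Proof. by move=> h s; apply/forall_inP => x xW; rewrite (matchedP h (subsetP s _ xW)). Qed.

(** At the new position matched keys cancel in pairs. Together with [zero_matching] this lets
    dependence climb and descend one level at a time. *)
Lemma zero_matched T i a V : fpf V a -> matched T i a V ->
  zero T (c.-1 + i) V -> zero T (c.-1 + i).+1 V.
Proof.
move=> fa ma z; apply/forallP => -[p b]; case: (ltngtP (val p) (c.-1 + i)) => pi.
- have := zeroP (p, b) z; rewrite /crow /= pi ltnS (ltnW pi) => -> //.
- by rewrite big1 // => x _; rewrite /crow /= ltnS leqNgt pi.
rewrite (addb_fpf fa) // => x xV; rewrite /crow /= pi.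
by rewrite (matchedP ma xV).
Qed.

Lemma zero_matching T i V : i <= d -> zero T (c.-1 + i).+1 V ->
  exists2 a, a \in Inv V & matched T i a V.
Proof.
move=> id z; have pl : c.-1 + i < c + d by move: c_gt0; lia.
have [|a aV ha] := @pairing _ _ (fun x => ch T x (c.-1 + i)) V.
  move=> b; rewrite odd_card_setI.
  by rewrite (zero_addb (p := Ordinal pl) (fun u => u == b) z).
by exists a => //; apply/forall_inP => x xV; rewrite ha.
Qed.

(** The first [c - 1] characters are those of the key. The next one is twisted by a xor of functions
    of earlier characters, which cancels over [V], so the vanishing passes to the untwisted key. *)
Lemma zero_xor T l V p : c <= l -> zero T l V -> p < c ->
  \big[@bxor k/bzero k]_(x in V) keyn x p = bzero k.
Proof.
move=> cl z pc; have pl : p < l by apply: leq_trans cl.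
have pcd : p < c + d by rewrite ltn_addr.
have := zero_bxor (p := Ordinal pcd) id z pl; rewrite /=.
case: (ltnP p c.-1) => pc1; first by under eq_bigr do rewrite ch_low //.
have {pc1 pcd} -> : p = c.-1 + 0 by move: c_gt0; lia.
under eq_bigr do rewrite ch_level //.
rewrite big_split /= exchange_big [X in bxor _ X]big1 ?bxorb0 ?addn0 // => q qc.
by apply: (zero_bxor _ z); rewrite (leq_trans qc) //; move: c_gt0 cl; lia.
Qed.

Lemma zero_last T l V x : c <= l -> zero T l V -> x \in V ->
  x = [ffun p => \big[@bxor k/bzero k]_(y in V :\ x) y p].
Proof.
move=> cl z xV; apply/ffunP => p; rewrite ffunE.
have := zero_xor cl z (ltn_ord p); rewrite (big_setD1 x) //=.
have E (y : key) : keyn y p = y p by rewrite /keyn valK.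
rewrite E; under eq_bigr do rewrite E.
by move/eqP; rewrite bxor_eq0 => /eqP.
Qed.

Lemma zero_even T l V : c <= l -> zero T l V -> ~~ odd #|V|.
Proof.
move=> cl z; rewrite odd_card_sum.
have c0 : 0 < c + d by rewrite ltn_addr.
by rewrite (zero_addb (p := Ordinal c0) (fun=> true) z) // (leq_trans c_gt0).
Qed.

(** The size is even, and two keys would coincide because each is the xor of the others; hence at
    least four keys. *)
Lemma zero_card T l V : c <= l -> zero T l V -> V != set0 ->
  exists2 v, #|V| = v.*2 & 2 <= v.
Proof.
move=> cl z V0; exists #|V|./2.
  by have := odd_double_half #|V|; rewrite (negbTE (zero_even cl z)).
case/set0Pn: (V0) => x xV.
have ev := zero_even cl z.
rewrite -(@leq_double 2); have := odd_double_half #|V|; rewrite (negbTE ev) add0n => ->.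
move: ev (cardsD1 x V); rewrite xV add1n => ev cV.
case: (eqVneq #|V :\ x| 1) => [|ne].
  2: by move: ev ne cV; case: #|V :\ x| => [|[|[|m]]] ev ne cV; move: ev; rewrite cV.
move/eqP/cards1P => [y' e].
have := zero_last cl z xV; rewrite e => /ffunP xE.
have : y' \in V :\ x by rewrite e set11.
rewrite !inE => /andP[/eqP[]]; apply/ffunP => p.
by rewrite xE ffunE big_set1.
Qed.

Lemma ch_inj T x y : (forall p, p < c -> ch T x p = ch T y p) -> x = y.
Proof.
move=> h; apply/ffunP => p.
have E (u : key) : keyn u p = u p by rewrite /keyn valK.
case: (ltnP p c.-1) => pc.
  by have := h p (ltn_ord p); rewrite !ch_low // !E.
have e : nat_of_ord p = c.-1 + 0.
  apply/eqP; rewrite addn0 eqn_leq pc andbT -ltnS prednK //.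
have L u : ch T u p = bxor (u p)
    (\big[@bxor k/bzero k]_(q < c + d | q < p) T (inord 0) q (ch T u q)).
  have := ch_level T u (leq0n d); rewrite -e /= => ->; congr bxor.
  by rewrite -E e addn0.
have := h p (ltn_ord p); rewrite !L.
rewrite (eq_bigr (fun q : 'I_(c + d) => T (inord 0) q (ch T y q))); last first.
  by move=> q qp; rewrite h // (ltn_trans qp).
set s := \big[_/_]_(_ < _ | _) _.
by move/(congr1 (fun u => bxor u s)); rewrite !bxorK.
Qed.

End DerivedCharacters.

(** * Independent edges are matched independently *)

Section Shift.
Variables (k s m : nat).
Implicit Types (U : {ffun 'I_m -> {ffun bits k -> bits s}}) (D : {ffun 'I_m * bits k -> bool}).

Definition scale (b : bool) (t : bits s) := if b then t else bzero s.

Lemma scaleD b b' t : scale (b (+) b') t = bxor (scale b t) (scale b' t).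
Proof. by case: b b' => [] []; rewrite /scale /= ?bxorbb ?bxorb0 ?bxor0b. Qed.

(** The move behind both peelings: a hash value changes by [t] exactly when [D] has value 1 on the
    row of the key, as [shift_sum] makes precise. *)
Definition shift U D t : {ffun 'I_m -> {ffun bits k -> bits s}} :=
  [ffun p => [ffun b => bxor (U p b) (scale (D (p, b)) t)]].

Lemma shiftK D t : involutive (fun U => shift U D t).
Proof. by move=> U; apply/ffunP => p; apply/ffunP => b; rewrite !ffunE bxorK. Qed.

Lemma shift_sum U D t (P : pred 'I_m) (f : 'I_m -> bits k) :
  \big[@bxor s/bzero s]_(p < m | P p) shift U D t p (f p) =
  bxor (\big[@bxor s/bzero s]_(p < m | P p) U p (f p))
       (scale (\big[addb/false]_(p < m | P p) D (p, f p)) t).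
Proof.
rewrite (big_morph (scale^~ t) (fun b b' => scaleD b b' t) (erefl : scale false t = _)).
by rewrite -big_split; apply: eq_bigr => p _; rewrite !ffunE.
Qed.

End Shift.

Section Peeling.
Variables (k r c d : nat).
Hypothesis c_gt0 : 0 < c.
Local Notation Om := (tables k r c d).
Local Notation tilde := {ffun 'I_d.+1 -> {ffun 'I_(c + d) -> {ffun bits k -> bits k}}}.
Local Notation key := (key k c).
Implicit Types (T : tilde) (x y : key) (V W : {set key}) (a : key -> key) (w : Om).
Local Notation dualT := {ffun 'I_(c + d) * bits k -> bool}.

Lemma dot_row T l x (D : dualT) :
  dot D (crow T l x) = \big[addb/false]_(p < c + d | p < l) D (p, ch T x p).
Proof.
have -> : dot D (crow T l x) = \big[addb/false]_p \big[addb/false]_b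
    (D (p, b) && ((p < l) && (ch T x p == b))).
  by rewrite pair_bigA /=; apply: eq_bigr => -[p b].
rewrite [RHS]big_mkcond; apply: eq_bigr => p _.
case: ltnP => pl /=; last by rewrite big1 // => b _; rewrite andbF.
rewrite (bigD1 (ch T x p)) //= eqxx andbT big1 ?addbF // => b /negPf nb.
by rewrite eq_sym nb andbF.
Qed.

Lemma eq_dot (P : finType) (D u v : P -> bool) : u =1 v -> dot D u = dot D v.
Proof. by move=> e; apply: eq_bigr => p _; rewrite e. Qed.

Definition edge_row T l a x pa := crow T l x pa (+) crow T l (a x) pa.

Definition edge_dual T l a V x (D : dualT) :=
  dot D (edge_row T l a x) && [forall y in V, ~~ dot D (edge_row T l a y)].

(** Without a dual functional, the Fredholm alternative writes the vector of the edge at [x] as a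
    sum of vectors of other edges, and their union is a dependent union of edges. *)
Lemma edge_dual_exists T l a V x : fpf V a -> x \in V -> ind (zero T l) a V ->
  exists D, edge_dual T l a (V :\: [set x; a x]) x D.
Proof.
move=> fa xV iV; set U' := V :\: _.
have [axV axx aax] := fpfP fa xV.
have sU' : U' \subset V := subsetDl _ _.
have cU' : eclosed a U' by rewrite (closedD fa) ?sub_pair // (closed_pair fa).
have fU' := fpf_sub fa sU' cU'.
have [[U sU hU]|[D [D0 DJ]]] :=
  dual_or_span (edge_row T l a) U' (edge_row T l a x); last first.
  by exists D; rewrite /edge_dual D0; apply/forall_inP.
(* The spanning set [U] consists of keys, not edges. An edge with both ends in [U] is counted twice
   and cancels, so [B] keeps the edges with exactly one end in [U]. *)
pose B := [set y in U' | (y \in U) (+) (a y \in U)].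
have sB : B \subset U' by apply/subsetP => y; rewrite inE => /andP[].
have cB : eclosed a B.
  apply/forall_inP => y; rewrite !inE => /andP[/andP[yx yV] yB].
  have yU' : y \in U' by rewrite !inE yx.
  have [+ _ aay] := fpfP fU' yU'; rewrite !inE => ->.
  by rewrite aay addbC.
have dB : [disjoint [set x; a x] & B].
  rewrite disjoint_sym disjoints_subset; apply/subsetP => y /(subsetP sB).
  by rewrite !inE => /andP[].
have : ~~ zero T l ([set x; a x] :|: B).
  apply: (indP iV).
  - by rewrite subUset sub_pair //= (subset_trans sB).
  - apply/forall_inP => y; rewrite in_setU => /orP[yp|yB]; rewrite in_setU.
      by rewrite (closedP (closed_pair fa xV) yp).
    by rewrite (closedP cB yB) orbT.
  - by apply/set0Pn; exists x; rewrite !inE eqxx.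
case/negP; apply/forallP => pa.
rewrite (eq_bigl [in [predU [set x; a x] & B]]) => [|y]; last by rewrite in_setU.
rewrite bigU //=.
have -> : \big[addb/false]_(y in [set x; a x]) crow T l y pa = edge_row T l a x pa.
  by rewrite big_setU1 ?big_set1 //= inE eq_sym.
rewrite hU.
have E (F : key -> bool) : \big[addb/false]_(y in B) F y =
    \big[addb/false]_(y in U') (((y \in U) (+) (a y \in U)) && F y).
  rewrite big_mkcond [RHS]big_mkcond; apply: eq_bigr => y _; rewrite [y \in B]inE.
  by case: (y \in U') => //=; case: (_ (+) _).
have E' (F : key -> bool) : \big[addb/false]_(y in U) F y =
    \big[addb/false]_(y in U') ((y \in U) && F y).
  rewrite big_mkcond [RHS]big_mkcond; apply: eq_bigr => y _.
  by case: (boolP (y \in U)) => [/(subsetP sU)->|] //=; rewrite if_same.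
rewrite E E' -big_split /=.
(* In this form the summand is invariant under [a], so the sum cancels along the edges. *)
have -> : \big[addb/false]_(y in U') ((y \in U) && edge_row T l a y pa
    (+) ((y \in U) (+) (a y \in U)) && crow T l y pa) =
  \big[addb/false]_(y in U') ((y \in U) && crow T l (a y) pa (+) (a y \in U) && crow T l y pa).
  apply: eq_bigr => y _; rewrite /edge_row.
  by case: (y \in U) (a y \in U) (crow T l y pa) (crow T l (a y) pa) => [] [] [] [].
rewrite (addb_fpf fU') // => y yU'; have [_ _ ->] := fpfP fU' yU'.
by rewrite addbC.
Qed.

Definition low i (E : pred Om) := forall w w', agree i w.1 w'.1 -> E w = E w'.

Definition tshift i (D : dualT) (t : bits k) w : Om :=
  ([ffun j => if j == inord i then shift (w.1 j) D t else w.1 j], w.2).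

Lemma tshiftK i D t : involutive (tshift i D t).
Proof.
move=> [T U]; rewrite /tshift /=; congr pair; apply/ffunP => j; rewrite !ffunE.
by case: eqP => // _; rewrite shiftK.
Qed.

Lemma tshift_agree i D t w : i <= d -> agree i w.1 (tshift i D t w).1.
Proof.
move=> id j ji; rewrite ffunE; case: eqP => // e.
by move: ji; rewrite e inordK // ltnn.
Qed.

Lemma ch_tshift i D t w x : i <= d -> ch (tshift i D t w).1 x (c.-1 + i) =
  bxor (ch w.1 x (c.-1 + i)) (scale (dot D (crow w.1 (c.-1 + i) x)) t).
Proof.
move=> id; rewrite !ch_level // dot_row -bxorA; congr bxor.
rewrite -shift_sum; apply: eq_bigr => p pi; rewrite ffunE eqxx.
by rewrite (ch_agree c_gt0 x (tshift_agree D t w id)) // ltnW.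
Qed.

(** Shifting table [i] along a functional dual to the edge at [x] preserves [E] and the matched
    state of the other edges of [W], while the two characters at the ends of this edge move apart by
    [t]; exactly one [t] makes them equal. *)
Lemma peel_edge i (E : pred Om) a V W x : i <= d -> low i E -> fpf V a ->
  (forall w, E w -> ind (zero w.1 (c.-1 + i)) a V) ->
  W \subset V -> eclosed a W -> x \in W ->
  #|[set w | [&& E w, matched w.1 i a (W :\: [set x; a x]) &
               ch w.1 (a x) (c.-1 + i) == ch w.1 x (c.-1 + i)]]| * #|{: bits k}| <=
  #|[set w | E w && matched w.1 i a (W :\: [set x; a x])]|.
Proof.
move=> id lE fa Eind sW cW xW; set W' := W :\: _; set l := c.-1 + i in Eind *.
have fW := fpf_sub fa sW cW.
(* The functional is picked by looking only at tables below level [i], so the move does not change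
   the choice. Where none exists, the zero default makes the move the identity. *)
pose D w := odflt [ffun=> false] [pick D | edge_dual w.1 l a W' x D].
have D_agree w w' : agree i w.1 w'.1 -> D w = D w'.
  move=> ag; rewrite /D; congr odflt; apply: eq_pick => F; rewrite /edge_dual.
  have e y : edge_row w.1 l a y =1 edge_row w'.1 l a y.
    by move=> pa; rewrite /edge_row !(crow_agree c_gt0 _ ag) // ltnW.
  rewrite (eq_dot _ (e x)); congr andb; apply: eq_forallb => y.
  by rewrite (eq_dot _ (e y)).
pose Phi t w := tshift i (D w) t w.
have DPhi t w : D (Phi t w) = D w by apply/esym/D_agree/tshift_agree.
have D_W' w y : y \in W' -> dot (D w) (crow w.1 l (a y)) = dot (D w) (crow w.1 l y).
  move=> yW'; suff: ~~ dot (D w) (edge_row w.1 l a y).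
    by rewrite /edge_row dotDr; do 2![case: (dot _ _)].
  rewrite /D; case: pickP => [F /andP[_ /forall_inP/(_ _ yW')] //|_] /=.
  by rewrite /dot big1 // => p _; rewrite ffunE.
have mPhi t w : matched (Phi t w).1 i a W' = matched w.1 i a W'.
  apply/forall_inP/forall_inP => h y yW'; have := h y yW';
    rewrite !ch_tshift // D_W' // => /eqP e; apply/eqP.
    by move: (congr1 (fun u => bxor u (scale (dot (D w) (crow w.1 l y)) t)) e); rewrite !bxorK.
  by rewrite e.
have := @averaging Om (bits k) Phi (fun w => E w && matched w.1 i a W')
  (fun w => ch w.1 (a x) l == ch w.1 x l) 1.
rewrite muln1 => H.
rewrite (_ : [set w | [&& _, _ & _]] = [set w | (E w && matched w.1 i a W') &&
  (ch w.1 (a x) l == ch w.1 x l)]); last by apply/setP => w; rewrite !inE andbA.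
apply: H => [t|t w|w /andP[Ew mw]].
- by apply: (@can_inj _ _ _ (Phi t)) => w; rewrite {1}/Phi DPhi tshiftK.
- by rewrite mPhi; congr andb; apply/esym/lE/tshift_agree.
have [F HF] := edge_dual_exists fW xW (ind_sub (Eind w Ew) sW).
have : dot (D w) (edge_row w.1 l a x).
  rewrite /D; case: pickP => [F' /andP[] //|/(_ F)].
  by rewrite HF.
rewrite /edge_row dotDr => dx.
rewrite -(cards1 (bxor (ch w.1 (a x) l) (ch w.1 x l))).
apply: subset_leq_card; apply/subsetP => t; rewrite !inE !ch_tshift // -/l => /eqP.
move: dx; rewrite /scale; case: (dot _ (crow _ _ x)); case: (dot _ (crow _ _ (a x))) => // _.
  by rewrite bxorb0 => ->; rewrite -bxorA [bxor t _]bxorC bxorA bxorbb bxor0b.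
by rewrite bxorb0 => <-; rewrite bxorA bxorbb bxor0b.
Qed.

Lemma peel i (E : pred Om) a V m : i <= d -> low i E -> fpf V a -> #|V| = m.*2 ->
  #|[set w | [&& E w, ind (zero w.1 (c.-1 + i)) a V & matched w.1 i a V]]|
    * #|{: bits k}| ^ m <= #|[set w | E w]|.
Proof.
move=> id lE fa cV.
(* Independence at this level depends only on lower tables, so it may join the conditioning event
   and stays available while the edges are peeled. *)
pose E0 w := E w && ind (zero w.1 (c.-1 + i)) a V.
have lE0 : low i E0.
  move=> w w' ag; rewrite /E0 (lE w w') //; congr andb; apply: eq_forallb => W.
  by rewrite (zero_agree c_gt0 ag) // ltnW.
have main W m' : W \subset V -> eclosed a W -> #|W| = m'.*2 ->
    #|[set w | E0 w && matched w.1 i a W]| * #|{: bits k}| ^ m' <= #|[set w | E0 w]|.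
  elim: m' W => [|m' IH] W sW cW cardW.
    rewrite muln1; apply: subset_leq_card; apply/subsetP => w.
    by rewrite !inE => /andP[].
  have /card_gt0P[x xW] : 0 < #|W| by rewrite cardW.
  have fW := fpf_sub fa sW cW.
  have cW' : eclosed a (W :\: [set x; a x]).
    by rewrite (closedD fW) ?sub_pair // (closed_pair fW).
  apply: leq_trans (IH (W :\: [set x; a x]) _ cW' _); first last.
  - by move: cardW; rewrite (card_fpf_pair fW xW) doubleS => -[].
  - by apply: subset_trans sW; apply: subsetDl.
  rewrite expnS mulnA leq_mul2r; apply/orP; right.
  apply: leq_trans (peel_edge id lE0 fa _ sW cW xW); last by move=> w /andP[].
  rewrite leq_mul2r; apply/orP; right; apply: subset_leq_card; apply/subsetP => w.
  rewrite !inE => /andP[-> mW]; rewrite (matched_sub mW (subsetDl _ _)) /=.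
  by rewrite (matchedP mW xW).
apply: leq_trans (_ : #|[set w | E0 w]| <= _); last first.
  by apply: subset_leq_card; apply/subsetP => w; rewrite !inE => /andP[].
apply: leq_trans (main V m (subxx _) (fpf_closed fa) cV).
rewrite leq_mul2r; apply/orP; right; apply: subset_leq_card; apply/subsetP => w.
by rewrite !inE /E0 -andbA.
Qed.

End Peeling.

(** * Selected keys *)

Section PeelingKeys.
Variables (k r c d : nat).
Local Notation Om := (tables k r c d).
Local Notation key := (key k c).
Variables (Q : {set key}) (f : key -> bits r -> {ffun qtype Q -> bits r} -> bool).
Hypothesis f_sel : selector f.
Implicit Types (x y : key) (S U V W : {set key}) (w : Om).
Local Notation dualT := {ffun 'I_(c + d) * bits k -> bool}.

Lemma derived_keyE w x p : derived_key w x p = ch w.1 x p.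
Proof. by rewrite ffunE derived_prefixE nth_mkseq. Qed.

Lemma dot_crow_full w x (D : dualT) :
  dot D (crow w.1 (c + d) x) = \big[addb/false]_(p < c + d) D (p, derived_key w x p).
Proof.
rewrite dot_row; apply: eq_big => [p|p _]; first by rewrite ltn_ord.
by rewrite derived_keyE.
Qed.

Definition indk w S := [forall W : {set key}, (W \subset S) && (W != set0) ==> ~~ zero w.1 (c + d) W].

Definition key_dual w S x (D : dualT) :=
  dot D (crow w.1 (c + d) x) && [forall y in S, ~~ dot D (crow w.1 (c + d) y)].

Lemma key_dual_exists w S x : x \in S -> indk w S -> exists D, key_dual w (S :\ x) x D.
Proof.
move=> xS /forallP iS.
have [[U sU hU]|[D [D0 DJ]]] :=
  dual_or_span (crow w.1 (c + d)) (S :\ x) (crow w.1 (c + d) x); last first.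
  by exists D; rewrite /key_dual D0; apply/forall_inP.
have /implyP := iS (x |: U); case/(_ _)/negP.
  rewrite subUset sub1set xS (subset_trans sU (subsetDl _ _)) /=.
  by apply/set0Pn; exists x; rewrite setU11.
apply/forallP => pa; rewrite big_setU1 /=; first by rewrite -hU addbb.
by apply/negP => /(subsetP sU); rewrite !inE eqxx.
Qed.

Definition hshift (D : dualT) (t : bits r) w : Om := (w.1, shift w.2 D t).

Lemma tornado_hshift D t w x :
  tornado (hshift D t w) x = bxor (tornado w x) (scale (dot D (crow w.1 (c + d) x)) t).
Proof.
rewrite dot_crow_full /tornado.
by rewrite (eq_bigr (fun p => shift w.2 D t p (derived_key w x p))) ?shift_sum.
Qed.

Definition pcount x := \max_(phi : {ffun qtype Q -> bits r}) #|[set rr : bits r | f x rr phi]|.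

(** The same move on the tables of the last hash function: [tornado w x] runs through all values
    while the other keys of [S], including all queries, keep theirs. For the fixed query values at
    most [pcount x] outcomes select [x]. *)
Lemma peel_key (E : pred Om) S U x :
  (forall w w', w.1 = w'.1 -> E w = E w') -> (forall w, E w -> indk w S) ->
  Q \subset S -> U \subset S -> x \in S -> x \notin Q -> x \notin U ->
  #|[set w | [&& E w, U \subset selected f w & x \in selected f w]]| * #|{: bits r}| <=
  #|[set w | E w && (U \subset selected f w)]| * pcount x.
Proof.
move=> lE Eind sQ sU xS xQ xU.
pose D w := odflt [ffun=> false] [pick D | key_dual w (S :\ x) x D].
pose Phi t w := hshift (D w) t w.
have DPhi t w : D (Phi t w) = D w by [].
have D_S w y : y \in S :\ x -> dot (D w) (crow w.1 (c + d) y) = false.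
  rewrite /D; case: pickP => [F /andP[_ /forall_inP h] /h/negbTE //|_] _ /=.
  by rewrite /dot big1 // => p _; rewrite ffunE.
have tPhi t w y : y \in S :\ x -> tornado (Phi t w) y = tornado w y.
  by move=> yS; rewrite tornado_hshift D_S // bxorb0.
have rPhi t w : restrictQ Q (Phi t w) = restrictQ Q w.
  apply/ffunP => q; rewrite !ffunE tPhi // !inE (subsetP sQ) ?(valP q) // andbT.
  by apply: contraNneq xQ => <-; apply: valP.
have sPhi t w y : y \in S :\ x -> (y \in selected f (Phi t w)) = (y \in selected f w).
  by move=> yS; rewrite !inE rPhi tPhi.
have := @averaging Om (bits r) Phi (fun w => E w && (U \subset selected f w))
  (fun w => x \in selected f w) (pcount x).
rewrite (_ : [set w | [&& _, _ & _]] = [set w | (E w && (U \subset selected f w)) &&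
  (x \in selected f w)]); last by apply/setP => w; rewrite !inE andbA.
apply=> [t|t w|w /andP[Ew _]].
- by apply: (@can_inj _ _ _ (Phi t)) => w; rewrite {1}/Phi DPhi /hshift /= shiftK; case: w.
- rewrite (lE (Phi t w) w) //; congr andb.
  have sU' y : y \in U -> y \in S :\ x.
    move=> yU; rewrite !inE (subsetP sU _ yU) andbT.
    by apply: contraNneq xU => <-.
  by apply/subsetP/subsetP => h y yU; move: (h y yU); rewrite sPhi // sU'.
have [F HF] := key_dual_exists xS (Eind w Ew).
have dx : dot (D w) (crow w.1 (c + d) x).
  rewrite /D; case: pickP => [F' /andP[] //|/(_ F)].
  by rewrite HF.
apply: leq_trans (leq_bigmax (restrictQ Q w)).
have injx : injective (fun t => bxor (tornado w x) t).
  by apply: (can_inj (g := fun t => bxor (tornado w x) t)) => t; rewrite bxorA bxorbb bxor0b.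
rewrite -(card_imset (mem [set t | x \in selected f (Phi t w)]) injx).
apply: subset_leq_card; apply/subsetP => _ /imsetP[t + ->].
by rewrite !inE tornado_hshift dx rPhi.
Qed.

Local Open Scope ring_scope.

Lemma pf_ge0 x : 0 <= pf f x.
Proof. by rewrite divr_ge0 ?ler0n. Qed.

Lemma card_bits s : #|{: bits s}| = (2 ^ s)%N.
Proof. by rewrite card_ffun card_bool card_ord. Qed.

Lemma card_bits_gt0 s : (0 < #|{: bits s}|)%N.
Proof. by rewrite card_bits expn_gt0. Qed.

Lemma pf_ge1 x : x \in Q -> 1 <= pf f x.
Proof.
move=> xQ; rewrite ler_pdivlMr ?mul1r ?ltr0n ?card_bits_gt0 // ler_nat.
apply: leq_trans (leq_bigmax [ffun=> bzero r]).
by apply: subset_leq_card; apply/subsetP => rr _; rewrite inE f_sel.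
Qed.

(** Query keys are always selected and have [pf] at least 1, so their factors may be added freely;
    the other keys are peeled one by one. The alternative [S \subset Q] accommodates dependences
    among the queries themselves. *)
Lemma peel_keys (E : pred Om) S : (forall w w', w.1 = w'.1 -> E w = E w') ->
  #|[set w | [&& E w, S \subset selected f w & (S \subset Q) || indk w (S :|: Q)]]|%:R
  <= (\prod_(x in S) pf f x) * #|[set w | E w]|%:R.
Proof.
move=> lE.
have prodQ (A : {set key}) : A \subset Q -> 1 <= \prod_(x in A) pf f x.
  move=> sA; apply: (big_ind (fun u : rat => 1 <= u)) => // [u v hu hv|x xA]; first by rewrite mulr_ege1.
  by rewrite pf_ge1 // (subsetP sA).
have [sSQ|nsSQ] := boolP (S \subset Q).
  apply: (@le_trans _ _ #|[set w | E w]|%:R).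
    by rewrite ler_nat; apply: subset_leq_card; apply/subsetP => w; rewrite !inE => /andP[].
  by rewrite ler_peMl ?ler0n ?prodQ.
pose E0 w := E w && indk w (S :|: Q).
have lE0 w w' : w.1 = w'.1 -> E0 w = E0 w'.
  by move=> e; rewrite /E0 (lE w w') // /indk e.
have main m (U : {set key}) : #|U| = m -> U \subset S :\: Q ->
    #|[set w | E0 w && (U \subset selected f w)]|%:R
    <= (\prod_(x in U) pf f x) * #|[set w | E0 w]|%:R.
  elim: m U => [|m IH] U cU sU.
    rewrite (cards0_eq cU) big_set0 mul1r ler_nat; apply: subset_leq_card.
    by apply/subsetP => w; rewrite !inE => /andP[].
  have /card_gt0P[x xU] : (0 < #|U|)%N by rewrite cU.
  have : x \in S :\: Q := subsetP sU _ xU.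
  rewrite inE => /andP[xQ xS].
  have sU' : U :\ x \subset S :\: Q := subset_trans (subsetDl _ _) sU.
  have /IH/(_ sU') IH' : #|U :\ x| = m by move: cU; rewrite (cardsD1 x) xU => -[].
  rewrite (big_setD1 x) //= -mulrA.
  apply: (le_trans _ (ler_wpM2l (pf_ge0 x) IH')).
  rewrite /pf mulrAC ler_pdivlMr ?ltr0n ?card_bits_gt0 // -!natrM ler_nat [leqRHS]mulnC.
  have := @peel_key E0 (S :|: Q) (U :\ x) x lE0 _ (subsetUr _ _) _ _ xQ.
  rewrite !inE eqxx xS => /(_ _ _ isT isT) H.
  apply: leq_trans (H _ _) => [|w /andP[]//|].
    rewrite leq_mul2r; apply/orP; right; apply: subset_leq_card; apply/subsetP => w.
    rewrite !inE => /andP[-> sUw] /=; rewrite (subset_trans (subsetDl _ _) sUw) /=.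
    by have := subsetP sUw _ xU; rewrite inE.
  by apply: subset_trans sU' _; apply: subset_trans (subsetDl _ _) (subsetUl _ _).
apply: (@le_trans _ _ #|[set w | E0 w && (S :\: Q \subset selected f w)]|%:R).
  rewrite ler_nat; apply: subset_leq_card; apply/subsetP => w; rewrite !inE /E0 /=.
  by move=> /and3P[-> sw ->] /=; apply: subset_trans (subsetDl _ _) sw.
apply: le_trans (main _ _ (erefl _) (subxx _)) _.
have Pge0 (A : {set key}) : 0 <= \prod_(x in A) pf f x by apply: prodr_ge0 => x _; apply: pf_ge0.
apply: ler_pM => //; rewrite ?ler0n //.
  by rewrite [leRHS](big_setID Q) /= ler_peMl // prodQ // subsetIr.
by rewrite ler_nat; apply: subset_leq_card; apply/subsetP => w; rewrite !inE => /andP[].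
Qed.

End PeelingKeys.

(** * The weights of the circuit recursion *)

Local Open Scope ring_scope.

Definition odd5 i := (\prod_(j < i) (j.*2 + 5))%N.

(** The 3 split off here, the number of matchings of four keys, is the numerator of the factor
    [3 / n] paid by each level. *)
Lemma dfact_odd5 i : dfact i.+2 = (3 * odd5 i)%N.
Proof.
elim: i => [|i IH]; first by rewrite !dfactS /dfact /odd5 !big_ord0.
by rewrite dfactS IH /odd5 big_ord_recr /= mulnA; congr (_ * _)%N; lia.
Qed.

(* All sizes are shifted: the index [i] stands for sets of [2 (i + 2)] keys. *)
Definition weight i : rat := if i is 0 then 1 else 4 * (16 / 5) ^+ i.

Lemma weight_ge1 i : 1 <= weight i.
Proof.
case: i => // i; rewrite /weight.
have : (1 : rat) <= (16 / 5) ^+ i.+1 by apply: exprn_ege1; lra.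
lra.
Qed.

Lemma weight_le4 i : weight i <= 4 * (16 / 5) ^+ i.
Proof. by case: i => [|i]; rewrite /weight ?expr0 ?mulr1. Qed.

(** Choices of the other [2i + 3] keys of a circuit within [2M + 3] keys, times the number of
    matchings of that circuit divided by 3. *)
Definition bincoef M i : rat := ('C(M.*2 + 3, i.*2 + 3) * odd5 i)%N%:R.

Lemma bincoefS M i : (i < M)%N ->
  bincoef M i.+1 * (i.+2)%:R = bincoef M i * ((M - i) * ((M - i).*2 - 1))%N%:R.
Proof.
move=> iM; rewrite /bincoef -!natrM; congr (_%:R).
have e1 := mul_bin_left (M.*2 + 3) (i.*2 + 3).
have e2 := mul_bin_left (M.*2 + 3) (i.*2 + 4).
have -> : odd5 i.+1 = (odd5 i * (i.*2 + 5))%N by rewrite /odd5 big_ord_recr.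
rewrite (_ : (i.*2 + 4).+1 = i.*2 + 5)%N in e2; last by lia.
rewrite (_ : (i.*2 + 3).+1 = i.*2 + 4)%N in e1; last by lia.
rewrite (_ : i.+1.*2 + 3 = i.*2 + 5)%N; last by lia.
rewrite (_ : M.*2 + 3 - (i.*2 + 3) = (M - i).*2)%N in e1; last by lia.
rewrite (_ : M.*2 + 3 - (i.*2 + 4) = (M - i).*2 - 1)%N in e2; last by lia.
move: ('C(_, i.*2 + 3)) ('C(_, i.*2 + 4)) ('C(_, i.*2 + 5)) e1 e2 => A B C.
move: (odd5 i) (M - i)%N ((M - i).*2 - 1)%N => o m m' e1 e2.
suff: ((i.*2 + 4) * ((i.*2 + 5) * C) * o = 2 * (A * o * (m * m')))%N.
  by rewrite (_ : i.*2 + 4 = 2 * i.+2)%N; [nia|lia].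
rewrite e2 mulnCA e1 -mul2n; ring.
Qed.

(* The ratio of consecutive terms of the sum bounded in [circuit_sum]. *)
Definition term_ratio (n M j : nat) : rat :=
  ((M - j) * ((M - j).*2 - 1))%N%:R / (j.+2)%:R * ((16 / 5) / n%:R).

Lemma term_ratio_ge0 n M j : 0 <= term_ratio n M j.
Proof. by rewrite mulr_ge0 ?divr_ge0 ?ler0n //; lra. Qed.

Lemma term_ratio_antitone n n' M j : (0 < n')%N -> (n' <= n)%N -> term_ratio n M j <= term_ratio n' M j.
Proof.
move=> n0 nn; apply: ler_wpM2l; first by rewrite divr_ge0 ?ler0n.
apply: ler_wpM2l; first by lra.
by rewrite lef_pV2 ?posrE ?ltr0n ?ler_nat // (leq_trans n0).
Qed.

Lemma bincoefE n M i : (0 < n)%N -> (i <= M)%N ->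
  bincoef M i * ((16 / 5) / n%:R) ^+ i = bincoef M 0 * \prod_(j < i) term_ratio n M j.
Proof.
move=> n0; elim: i => [|i IH] iM; first by rewrite big_ord0 expr0.
rewrite big_ord_recr /= mulrA -(IH (ltnW iM)) exprS /term_ratio.
have i2 : (i.+2)%:R != 0 :> rat by rewrite pnatr_eq0.
have n2 : n%:R != 0 :> rat by rewrite pnatr_eq0 -lt0n.
rewrite -[bincoef M i.+1](mulfK i2) bincoefS //.
move: (bincoef M i) ((M - i) * _)%N (_ ^+ i) i2 n2 => A B C; move: (i.+2%:R) (n%:R) => I N I0 N0.
by field; rewrite N0 I0.
Qed.

Lemma bincoef0 M : bincoef M 0 = (M.*2 + 3)%:R * (M.*2 + 1)%:R * (M + 1)%:R / 3.
Proof.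
rewrite /bincoef /odd5 big_ord0 muln1 add0n.
have := bin_ffact (M.*2 + 3) 3; rewrite !ffactnS ffactn0 => e.
have {}e : ('C(M.*2 + 3, 3) * 6 = (M.*2 + 3) * (M.*2 + 1) * (2 * (M + 1)))%N.
  rewrite -[6%N]/(3`!) e muln1 (_ : (M.*2 + 3).-1 = M.*2 + 2)%N; last by lia.
  by rewrite (_ : (M.*2 + 2).-1 = M.*2 + 1)%N; lia.
have := congr1 (fun u => u%:R : rat) e; rewrite !natrM; lra.
Qed.

(** * Exact evaluation of the circuit recursion for small sizes *)

Lemma sum_horner (F : nat -> rat) m s :
  \sum_(i < m.+1) \prod_(j < i) F (s + j)%N =
  1 + (if m is m'.+1 then F s * \sum_(i < m'.+1) \prod_(j < i) F (s.+1 + j)%N else 0).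
Proof.
rewrite big_ord_recl big_ord0; congr (_ + _); case: m => [|m]; first by rewrite big_ord0.
rewrite mulr_sumr; apply: eq_bigr => i _; rewrite big_ord_recl addn0; congr (_ * _).
by apply: eq_bigr => j _; rewrite /bump /= addnS.
Qed.

(* Numerator and denominator of the Horner scheme of [sum_horner]. *)
Fixpoint hornN (n M m : nat) : N * N :=
  if m is m'.+1 then
    let: (a, b) := hornN n M m' in
    let q := (N.of_nat n * N.of_nat 5 * N.of_nat (M - m').+1 * b)%num in
    ((q + N.of_nat 16 * N.of_nat (m * (m.*2 - 1)) * a)%num, q)
  else (1%num, 1%num).

(** With [B = bincoef M 0] and [s = a / b] this is [B (4 s - 3) <= 4 (16/5)^M] multiplied by
    [3 * 5^M * b]; the number [e] is [3 * 5^M * B]. *)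
Definition checkN n M :=
  let: (a, b) := hornN n M M in
  let e := (N.of_nat ((M.*2 + 3) * (M.*2 + 1) * (M + 1)) * N.of_nat 5 ^ N.of_nat M)%num in
  (N.of_nat 4 * e * a <=? (N.of_nat 12 * N.of_nat 16 ^ N.of_nat M + N.of_nat 3 * e) * b)%num.

(** These are the sizes for which the geometric estimate used later is too crude. The smallest
    alphabet suffices, since the ratios of the terms decrease in [n]. *)
Lemma checkN_256 : all (checkN 256) (iota 0 81).
Proof. by vm_compute. Qed.

Definition NR (x : N) : rat := (N.to_nat x)%:R.

Lemma NRD x y : NR (x + y)%num = NR x + NR y.
Proof. by rewrite /NR N2Nat.inj_add natrD. Qed.

Lemma NRM x y : NR (x * y)%num = NR x * NR y.
Proof. by rewrite /NR N2Nat.inj_mul natrM. Qed.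

Lemma NRX x m : NR (x ^ N.of_nat m)%num = NR x ^+ m.
Proof.
elim: m => [|m IH]; first by rewrite expr0.
by rewrite Nat2N.inj_succ N.pow_succ_r' NRM IH exprS.
Qed.

Lemma NR_nat m : NR (N.of_nat m) = m%:R.
Proof. by rewrite /NR Nat2N.id. Qed.

Lemma NR_le x y : (x <=? y)%num -> NR x <= NR y.
Proof. by move/N.leb_le => h; rewrite /NR ler_nat; lia. Qed.

Local Arguments N.mul : simpl never.
Local Arguments N.add : simpl never.
Local Arguments N.of_nat : simpl never.

Lemma hornN_correct n M m : (0 < n)%N -> (m <= M)%N -> 0 < NR (hornN n M m).2 /\
  NR (hornN n M m).1 =
  (\sum_(i < m.+1) \prod_(j < i) term_ratio n M (M - m + j)) * NR (hornN n M m).2.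
Proof.
move=> n0; elim: m => [|m IH] mM.
  by rewrite big_ord_recl !big_ord0 /= addr0 mul1r.
case: (IH (ltnW mM)) => {IH} /=; case: (hornN n M m) => a b /= b0 ea.
rewrite NRD !NRM !NR_nat (sum_horner (term_ratio n M)).
rewrite (_ : (M - m.+1).+1 = M - m)%N; last by lia.
rewrite ea; set s := \sum_(_ < _) _.
rewrite /term_ratio (_ : M - (M - m.+1) = m.+1)%N; last by lia.
rewrite (_ : (M - m.+1).+2 = (M - m).+1)%N; last by lia.
have nR : 0 < n%:R :> rat by rewrite ltr0n.
have q0 : 0 < (M - m).+1%:R :> rat by rewrite ltr0n.
split; first by rewrite !mulr_gt0.
move: (m.+1 * _)%N (_.+1%:R) (n%:R) q0 nR => p q h q0 h0; field.
by rewrite !lt0r_neq0.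
Qed.

Lemma circuit_sum_check n0 n M : (0 < n0)%N -> (n0 <= n)%N -> checkN n0 M ->
  bincoef M 0 * (1 + 4 * (\sum_(i < M.+1) \prod_(j < i) term_ratio n M j - 1)) <= 4 * (16 / 5) ^+ M.
Proof.
move=> n0_gt0 n0n; rewrite /checkN; have := hornN_correct n0_gt0 (leqnn M).
case: (hornN n0 M M) => a b /= [b0 ea] /NR_le.
rewrite !(NRM, NRD, NRX, NR_nat) ea.
set s := \sum_(_ < _) _; set s' := \sum_(_ < _) _ => H.
have le_s : s' <= s.
  rewrite /s /s' subnn; apply: ler_sum => i _; apply: ler_prod => j _; rewrite term_ratio_ge0 /=.
  exact: term_ratio_antitone.
clearbody s s'.
have {H} : 4 * (((M.*2 + 3) * (M.*2 + 1) * (M + 1))%N%:R * 5 ^+ M) * s <=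
    12 * 16 ^+ M + 3 * (((M.*2 + 3) * (M.*2 + 1) * (M + 1))%N%:R * 5 ^+ M) :> rat.
  by move: H; rewrite mulrA ler_pM2r.
have -> : (((M.*2 + 3) * (M.*2 + 1) * (M + 1))%N%:R : rat) = 3 * bincoef M 0.
  by rewrite bincoef0 !natrM; field.
have p5 : 0 < (5 : rat) ^+ M by apply: exprn_gt0.
have B0 : 0 <= bincoef M 0 by rewrite ler0n.
rewrite expr_div_n => H.
rewrite mulrA ler_pdivlMr //.
have le_B : bincoef M 0 * s' <= bincoef M 0 * s by rewrite ler_wpM2l.
have := ler_wpM2r (ltW p5) le_B.
move: (5 ^+ M) (16 ^+ M) (bincoef M 0) H => A B C.
lra.
Qed.

Lemma circuit_sum_small n M : (256 <= n)%N -> (M <= 80)%N ->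
  bincoef M 0 * (1 + 4 * (\sum_(i < M.+1) \prod_(j < i) term_ratio n M j - 1)) <= 4 * (16 / 5) ^+ M.
Proof.
move=> n256 M80; apply: (circuit_sum_check _ n256); first by [].
by apply: (allP checkN_256); rewrite mem_iota.
Qed.

Local Close Scope ring_scope.

(** * The circuit recursion for large sizes *)

Local Open Scope ring_scope.

(** Repeated squaring, rounded down at each stage to keep the numerals small; [1131/1000] is just
    below [112/99]. *)
Lemma pow80_ge (x : rat) : 1131 / 1000 <= x -> 134 * 134 <= x ^+ 80.
Proof.
have mono (a b u v : rat) : 0 <= a -> 0 <= b -> a <= u -> b <= v -> a * b <= u * v.
  by move=> a0 b0 au bv; apply: ler_pM.
move=> h1.
have h2 : 1279 / 1000 <= x ^+ 2 by rewrite expr2; have := mono _ _ _ _ _ _ h1 h1; lra.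
have h4 : 1635 / 1000 <= x ^+ 4.
  by rewrite (exprD x 2 2); have := mono _ _ _ _ _ _ h2 h2; lra.
have h5 : 1849 / 1000 <= x ^+ 5.
  by rewrite exprS; have := mono _ _ _ _ _ _ h1 h4; lra.
have h10 : 341 / 100 <= x ^+ 10.
  by rewrite (exprD x 5 5); have := mono _ _ _ _ _ _ h5 h5; lra.
have h20 : 116 / 10 <= x ^+ 20.
  by rewrite (exprD x 10 10); have := mono _ _ _ _ _ _ h10 h10; lra.
have h40 : 134 <= x ^+ 40.
  by rewrite (exprD x 20 20); have := mono _ _ _ _ _ _ h20 h20; lra.
have c0 : 0 <= 134 :> rat by rewrite ler0n.
by rewrite (exprD x 40 40); exact: (mono _ _ _ _ c0 c0 h40 h40).
Qed.

(** [112/99] is the quotient of the allowed rate [16/5] by the rate [99/35 = 1 + 64/35] of the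
    binomial estimate; the left side is the polynomial factor that this surplus has to absorb. *)
Lemma geometric_beats_square M : (80 <= M)%N ->
  (M.*2 + 3)%:R * (M.*2 + 1)%:R / 3 * (99 / 64) <= (112 / 99) ^+ M :> rat.
Proof.
elim: M => // M IH; rewrite leq_eqVlt => /orP[/eqP <-|lt].
  apply: le_trans (pow80_ge _); last by lra.
  rewrite !natrD -mul2n !natrM -[80%:R]/(8 * 10)%N%:R natrM; lra.
have {}IH := IH lt; rewrite exprS.
apply: (@le_trans _ _ (112 / 99 * ((M.*2 + 3)%:R * (M.*2 + 1)%:R / 3 * (99 / 64)))); last first.
  by apply: ler_wpM2l IH; lra.
rewrite doubleS (_ : M.*2.+2 + 3 = M.*2 + 5)%N; last by lia.
rewrite (_ : M.*2.+2 + 1 = M.*2 + 3)%N; last by lia.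
have : 80 <= M%:R :> rat by rewrite ler_nat.
rewrite !natrD -mul2n !natrM; move: (M%:R) => m m80; nra.
Qed.

(** The size hypothesis bounds [(2(M-i) - 1) / n] by [4/7], and [16/5 * 4/7 = 64/35]. The remaining
    quotients [(M-i) / (i+2)] telescope to a binomial coefficient. *)
Lemma term_ratio_prod n M i : (256 <= n)%N -> (7 * M.+2 <= 2 * n)%N -> (i <= M)%N ->
  \prod_(j < i) term_ratio n M j <= 'C(M.+1, i.+1)%:R / M.+1%:R * (64 / 35) ^+ i.
Proof.
move=> n256 Mn; elim: i => [|i IH] iM.
  by rewrite big_ord0 bin1 expr0 mulr1 divff // pnatr_eq0.
rewrite big_ord_recr /=.
have nR : 0 < n%:R :> rat by rewrite ltr0n (leq_trans _ n256).
have r_le : term_ratio n M i <= (M - i)%N%:R / i.+2%:R * (64 / 35).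
  have -> : term_ratio n M i = (M - i)%N%:R / i.+2%:R * (((M - i).*2 - 1)%N%:R * (16 / 5) / n%:R).
    by rewrite /term_ratio natrM; ring.
  apply: ler_wpM2l; first by rewrite divr_ge0 ?ler0n.
  rewrite (ler_pdivrMr _ _ nR).
  have : (((M - i).*2 - 1)%N * 7)%:R <= (4 * n)%N%:R :> rat by rewrite ler_nat; lia.
  by rewrite !natrM; lra.
apply: le_trans (ler_pM _ (term_ratio_ge0 _ _ _) (IH (ltnW iM)) r_le) _.
  by apply: prodr_ge0 => j _; apply: term_ratio_ge0.
have := congr1 (fun u => u%:R : rat) (mul_bin_left M.+1 i.+1).
rewrite subSS !natrM => e.
have i0 : i.+2%:R != 0 :> rat by rewrite pnatr_eq0.
have M0 : M.+1%:R != 0 :> rat by rewrite pnatr_eq0.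
have -> : 'C(M.+1, i.+2)%:R = (M - i)%N%:R * 'C(M.+1, i.+1)%:R / i.+2%:R :> rat.
  by rewrite -e mulrC mulKf.
rewrite exprS le_eqVlt; apply/orP; left; apply/eqP.
move: (_ ^+ i) ('C(_, _)) i0 M0 => A B; move: (i.+2%:R) (M.+1%:R) => x y x0 y0; field.
by rewrite x0 y0.
Qed.

Lemma binomial_tail (z : rat) N :
  \sum_(i < N) 'C(N, i.+1)%:R * z ^+ i.+1 <= (z + 1) ^+ N.
Proof.
rewrite exprD1n big_ord_recl /= expr0 bin0 mulr1n; apply: ler_wpDl => //.
by apply: ler_sum => i _; rewrite mulr_natl.
Qed.

(** The weights are a supersolution of the recursion over levels: summing over all circuits among
    the given keys returns at most the weight of the largest size. *)
Lemma circuit_sum n M : (256 <= n)%N -> (7 * M.+2 <= 2 * n)%N ->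
  \sum_(i < M.+1) bincoef M i * weight i / n%:R ^+ i <= weight M.
Proof.
move=> n256 Mn; have n0 : (0 < n)%N by apply: leq_trans n256.
case: M Mn => [|M] Mn; first by rewrite big_ord_recl /bincoef /odd5 !big_ord0 binn muln1 /= expr0; lra.
set M' := M.+1 in Mn *.
have -> : \sum_(i < M'.+1) bincoef M' i * weight i / n%:R ^+ i =
    bincoef M' 0 * (1 + 4 * (\sum_(i < M'.+1) \prod_(j < i) term_ratio n M' j - 1)).
  rewrite [in LHS]big_ord_recl [in RHS]big_ord_recl big_ord0 /= expr0 divr1 mulr1.
  rewrite addrAC subrr add0r mulrDr mulr1; congr (_ + _).
  rewrite mulrCA !mulr_sumr; apply: eq_bigr => i _.
  have := bincoefE n0 (ltn_ord (lift ord0 i) : (lift ord0 i <= M')%N) => /= <-.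
  by rewrite [in RHS]expr_div_n; ring.
change (weight M') with (4 * (16 / 5) ^+ M' : rat); clearbody M'; clear M.
case: (leqP M' 80) => M80; first exact: circuit_sum_small.
set S := \sum_(_ < _) _.
have B0 : 0 <= bincoef M' 0 by rewrite ler0n.
suff: bincoef M' 0 * S <= (16 / 5) ^+ M' by lra.
have leS : S <= (99 / 35) ^+ M'.+1 * (35 / 64) / M'.+1%:R.
  have leS i : (i < M'.+1)%N -> \prod_(j < i) term_ratio n M' j <=
      'C(M'.+1, i.+1)%:R * (64 / 35) ^+ i.+1 * (35 / 64) / M'.+1%:R.
    move=> iM; apply: le_trans (term_ratio_prod n256 Mn iM) _.
    have y0 : M'.+1%:R != 0 :> rat by rewrite pnatr_eq0.
    rewrite exprS le_eqVlt; apply/orP; left; apply/eqP.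
    by move: ('C(_, _)%:R : rat) (_ ^+ i) (M'.+1%:R) y0 => A B y y0; field.
  apply: (@le_trans _ _ (\sum_(i < M'.+1)
      'C(M'.+1, i.+1)%:R * (64 / 35) ^+ i.+1 * (35 / 64) / M'.+1%:R)).
    by apply: ler_sum => i _; apply: leS.
  rewrite -2!mulr_suml; apply: ler_wpM2r; first by rewrite invr_ge0 ler0n.
  apply: ler_wpM2r; first by lra.
  rewrite (_ : 99 / 35 = 64 / 35 + 1); last by lra.
  exact: binomial_tail.
apply: le_trans (ler_wpM2l B0 leS) _.
have le_geo := geometric_beats_square (ltnW M80).
have -> : 16 / 5 = 99 / 35 * (112 / 99) :> rat by lra.
have p0 : 0 <= (99 / 35) ^+ M' :> rat by apply: exprn_ge0; lra.
rewrite (exprMn _ (99 / 35) (112 / 99)); apply: le_trans (ler_wpM2l p0 le_geo).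
rewrite bincoef0 exprS [(M' + 1)%N]addn1 le_eqVlt; apply/orP; left; apply/eqP.
have y0 : M'.+1%:R != 0 :> rat by rewrite pnatr_eq0.
by move: (_ ^+ M') (M'.+1%:R : rat) ((M'.*2 + 3)%:R : rat) ((M'.*2 + 1)%:R : rat) y0 => A y a b y0; field.
Qed.

(* With [w = M + 2]: [(2w-1)!!] bounds the number of matchings of [2w - 1] keys that miss
   one of them, and [(2w-1)!] is the number of orderings of these keys. *)
Definition paths M : rat := (dfact M.+2)%:R ^+ 2 / ((M.*2 + 3)`!)%:R.

Lemma paths0 : paths 0 = 3 / 2.
Proof.
rewrite /paths (_ : dfact 2 = 3)%N; last by rewrite !dfactS /dfact big_ord0.
by rewrite (_ : (0.*2 + 3)`! = 6)%N //; lra.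
Qed.

Lemma pathsS M : paths M.+1 = paths M * ((M.*2 + 5)%:R / (M.*2 + 4)%:R).
Proof.
rewrite /paths dfactS natrM (_ : M.+2.*2.+1 = M.*2 + 5)%N; last by lia.
rewrite (_ : M.+1.*2 + 3 = (M.*2 + 3).+2)%N; last by lia.
rewrite !factS !natrM (_ : (M.*2 + 3).+2 = M.*2 + 5)%N; last by lia.
rewrite (_ : (M.*2 + 3).+1 = M.*2 + 4)%N; last by lia.
have h1 : (M.*2 + 5)%:R != 0 :> rat by rewrite pnatr_eq0 addn_eq0 andbF.
have h2 : (M.*2 + 4)%:R != 0 :> rat by rewrite pnatr_eq0 addn_eq0 andbF.
have h3 : ((M.*2 + 3)`!)%:R != 0 :> rat by rewrite pnatr_eq0 -lt0n fact_gt0.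
move: (_`!%:R) (dfact _) ((M.*2 + 5)%:R : rat) ((M.*2 + 4)%:R : rat) h1 h2 h3 => A B a b h1 h2 h3.
by field; rewrite h1 h2 h3.
Qed.

Lemma paths_ge0 M : 0 <= paths M.
Proof. by rewrite divr_ge0 ?exprn_ge0 ?ler0n. Qed.

Lemma paths_linear M : paths M <= M%:R + 2.
Proof.
elim: M => [|M IH]; first by rewrite paths0; lra.
rewrite pathsS; have M0 : 0 <= M%:R :> rat by rewrite ler0n.
have b0 : 0 < (M.*2 + 4)%:R :> rat by rewrite ltr0n addn_gt0 orbT.
rewrite mulrA ler_pdivrMr //.
move: (paths_ge0 M) IH; rewrite -[M.+1]addn1 !natrD -mul2n natrM; move: (M%:R) (paths M) M0 => m p m0 p0 pm.
have h : p * (2 * m + 5) <= (m + 2) * (2 * m + 5) by apply: ler_wpM2r => //; lra.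
apply: (le_trans h); rewrite -subr_ge0 (_ : _ - _ = m + 2); last by ring.
by lra.
Qed.

(** From index 3 on the quotient of consecutive values is at most [11/10]. The constant [37/20] is
    dictated by index 3, where the bound is nearly tight. *)
Lemma paths_geometric M : paths M <= 37 / 20 * (11 / 10) ^+ M.
Proof.
have step i : paths i.+1 * (i.*2 + 4)%:R = paths i * (i.*2 + 5)%:R.
  by rewrite pathsS mulrA mulfVK // pnatr_eq0 addn_eq0 andbF.
have s0 : paths 1 * 4 = paths 0 * 5 := step 0.
have s1 : paths 2 * 6 = paths 1 * 7 := step 1.
have s2 : paths 3 * 8 = paths 2 * 9 := step 2.
rewrite paths0 in s0.
elim: M => [|[|[|[|M]]] IH].
- by rewrite paths0 expr0; clear; lra.
- by rewrite expr1; move: s0; clear; move: (paths 1) => p; lra.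
- by rewrite expr2; move: s0 s1; clear; move: (paths 1) (paths 2) => p q; lra.
- rewrite 2!exprS expr1; move: s0 s1 s2; clear.
  by move: (paths 1) (paths 2) (paths 3) => p q r; lra.
clear s0 s1 s2.
have := step M.+3; have b0 : 0 < (M.+3.*2 + 4)%:R :> rat by rewrite ltr0n addn_gt0 orbT.
rewrite exprS -(ler_pM2r b0) => ->.
have M0 : 0 <= M%:R :> rat by rewrite ler0n.
rewrite (_ : M.+3.*2 + 4 = 2 * M + 10)%N in b0 *; last by lia.
rewrite (_ : M.+3.*2 + 5 = 2 * M + 11)%N; last by lia.
rewrite (natrD _ (2 * M) 11) (natrD _ (2 * M) 10) natrM; move: (M%:R) (paths_ge0 M.+3) M0 IH.
move: (paths M.+3) ((11 / 10) ^+ M.+3) => p q m p0 m0 pq.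
have h : p * (2 * m + 11) <= 37 / 20 * q * (2 * m + 11) by apply: ler_wpM2r => //; lra.
apply: (le_trans h); rewrite -subr_ge0 (_ : _ - _ = 37 / 100 * q * m); last by field.
by apply: mulr_ge0 m0; apply: mulr_ge0; lra.
Qed.

(** The geometric rate is [11/10 * 16/5 * 1/4 = 22/25] with leading constant [4 * 37/20 = 37/5], so
    the total is at most [185/3], below [63 = 7 * 9]. *)
Lemma path_sum W (x : rat) : 0 <= x -> x <= 1 / 4 ->
  \sum_(M < W) paths M * (4 * (16 / 5) ^+ M) * x ^+ M <= 63.
Proof.
move=> x0 x4.
have le M : paths M * (4 * (16 / 5) ^+ M) * x ^+ M <= 37 / 5 * (22 / 25) ^+ M.
  have -> : 22 / 25 = 11 / 10 * (16 / 5 * (1 / 4)) :> rat by lra.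
  rewrite (exprMn _ (11 / 10)) (exprMn _ (16 / 5) (1 / 4)).
  move: (paths_geometric M) (paths_ge0 M).
  have : x ^+ M <= (1 / 4) ^+ M by apply: lerXn2r.
  have : 0 <= (16 / 5) ^+ M :> rat by apply: exprn_ge0; lra.
  have : 0 <= x ^+ M by apply: exprn_ge0.
  move: (x ^+ M) ((1 / 4) ^+ M) ((11 / 10) ^+ M) ((16 / 5) ^+ M) (paths M) => a b u v p a0 v0 ab pu p0.
  have := ler_pM p0 a0 pu ab.
  move=> /(ler_wpM2l v0); lra.
apply: (@le_trans _ _ (\sum_(M < W) 37 / 5 * (22 / 25) ^+ M)); first by apply: ler_sum.
rewrite -mulr_sumr.
suff: \sum_(M < W) (22 / 25) ^+ M <= 25 / 3 :> rat by lra.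
have -> : \sum_(M < W) (22 / 25) ^+ M = (1 - (22 / 25) ^+ W) * (25 / 3) :> rat.
  by elim: W => [|W IH]; rewrite ?big_ord0 ?expr0 ?big_ord_recr ?IH /= ?exprS; lra.
have : 0 <= (22 / 25) ^+ W :> rat by apply: exprn_ge0; lra.
lra.
Qed.

Local Close Scope ring_scope.

(** * Circuits at the lower levels *)

Local Open Scope ring_scope.

Lemma Pr_ge0 (T : finType) (E : pred T) : 0 <= Pr E.
Proof. by rewrite divr_ge0 ?ler0n. Qed.

Lemma Pr_le1 (T : finType) (E : pred T) : Pr E <= 1.
Proof.
rewrite /Pr; case: (posnP #|T|) => [->|T0]; first by rewrite invr0 mulr0.
by rewrite ler_pdivrMr ?ltr0n // mul1r ler_nat max_card.
Qed.

Lemma Pr_mono (T : finType) (E F : pred T) : (forall w, E w -> F w) -> Pr E <= Pr F.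
Proof.
move=> h; rewrite ler_wpM2r ?invr_ge0 ?ler0n // ler_nat; apply: subset_leq_card.
by apply/subsetP => w; rewrite !inE; apply: h.
Qed.

Lemma Pr_eq0 (T : finType) (E : pred T) : (forall w, ~~ E w) -> Pr E = 0.
Proof.
by move=> h; rewrite /Pr (_ : [set w | E w] = set0) ?cards0 ?mul0r //;
  apply/setP => w; rewrite !inE (negbTE (h w)).
Qed.

Lemma Pr_union (T I : finType) (P : pred I) (E : pred T) (F : I -> pred T) :
  (forall w, E w -> exists2 i, P i & F i w) -> Pr E <= \sum_(i | P i) Pr (F i).
Proof.
move=> h; rewrite /Pr -mulr_suml ler_wpM2r ?invr_ge0 ?ler0n // -natr_sum ler_nat.
apply: (@leq_trans #|\bigcup_(i | P i) [set w | F i w]|).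
  apply: subset_leq_card; apply/subsetP => w; rewrite inE => /h[i Pi Fi].
  by apply/bigcupP; exists i; rewrite ?inE.
elim/big_rec2: _ => [|i s A _ le]; first by rewrite cards0.
by apply: leq_trans (leq_card_setU _ _) _; rewrite leq_add2l.
Qed.

Lemma subset_sum (K : finType) (S : {set K}) (M : nat) (F : {set K} -> rat) (h : nat -> rat) :
  #|S| = (M.*2 + 3)%N ->
  (forall U : {set K}, U \subset S -> F U <= \sum_(j < M.+1) (#|U| == (j.*2 + 3)%N)%:R * h j) ->
  \sum_(U : {set K} | U \subset S) F U <= \sum_(j < M.+1) 'C(M.*2 + 3, j.*2 + 3)%:R * h j.
Proof.
move=> cS le; apply: (le_trans (ler_sum _ le)); rewrite exchange_big /=.
apply: ler_sum => j _; rewrite -mulr_suml -natr_sum -cS -cards_draws -sum1_card.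
rewrite le_eqVlt; apply/orP; left; apply/eqP; congr (_%:R * _).
rewrite big_mkcond [RHS]big_mkcond /=; apply: eq_bigr => U _.
by rewrite inE; case: (U \subset S) => //=; case: (_ == _).
Qed.

Section Circuits.
Variables (k r c d : nat).
Hypotheses (k_ge8 : (8 <= k)%N) (c_gt0 : (0 < c)%N).
Local Notation Om := (tables k r c d).
Local Notation key := (key k c).
Local Notation n := #|{: bits k}|.
Implicit Types (x y : key) (S U V W : {set key}) (w : Om).

Lemma n_ge256 : (256 <= n)%N.
Proof. by rewrite card_bits -[256%N]/(2 ^ 8)%N leq_exp2l. Qed.

Lemma nR_gt0 : 0 < n%:R :> rat.
Proof. by rewrite ltr0n (leq_trans _ n_ge256). Qed.

Lemma peel_Pr i (E : pred Om) a V m : (i <= d)%N -> low i E -> fpf V a -> #|V| = m.*2 ->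
  Pr (fun w => [&& E w, ind (zero w.1 (c.-1 + i)) a V & matched w.1 i a V])
  <= Pr E / n%:R ^+ m.
Proof.
move=> id lE fa cV; have := peel c_gt0 id lE fa cV => h.
rewrite /Pr mulrAC ler_wpM2r ?invr_ge0 ?ler0n // ler_pdivlMr ?exprn_gt0 ?nR_gt0 //.
by rewrite -natrX -natrM ler_nat.
Qed.

Definition circ i V w := circuit (zero w.1 (c.-1 + i).+1) V.

Lemma circ_card i V w : circ i V w -> exists M, #|V| = M.+2.*2.
Proof.
case/and3P => V0 zV _.
have [|v cV v2] := zero_card c_gt0 _ zV V0; first by rewrite -addSn prednK // leq_addr.
by exists v.-2; rewrite cV; case: v v2 {cV} => [|[|]].
Qed.

Lemma circ_last i V w x : circ i V w -> x \in V ->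
  x = [ffun p => \big[@bxor k/bzero k]_(y in V :\ x) y p].
Proof.
case/and3P => V0 zV _ xV; apply: (zero_last c_gt0 _ zV xV).
by rewrite -addSn prednK // leq_addr.
Qed.

(** Without the edge at [x], the matching of a circuit is independent one level down: a dependent
    union of the remaining edges would, being matched, be a dependent proper subset of the circuit.
    The [M + 1] remaining edges can then be peeled. *)
Lemma circ_step i V M (E : pred Om) : (i <= d)%N -> low i E -> (forall w, circ i V w -> E w) ->
  #|V| = M.+2.*2 -> Pr (circ i V) <= (dfact M.+2)%:R / n%:R ^+ M.+1 * Pr E.
Proof.
move=> id lE cE cV; have /card_gt0P[x xV] : (0 < #|V|)%N by rewrite cV.
pose V' (a : key -> key) := V :\: [set x; a x].
pose F (a : {ffun key -> key}) w :=
  [&& E w, ind (zero w.1 (c.-1 + i)) a (V' a) & matched w.1 i a (V' a)].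
apply: (le_trans (Pr_union (P := [in Inv V]) (F := F) _)).
  move=> w cw; have /and3P[_ zV _] := cw.
  have [a aV ma] := zero_matching c_gt0 id zV; have fa := Inv_fpf aV.
  exists a => //; rewrite /F cE // (matched_sub ma (subsetDl _ _)) andbT /=.
  apply/forallP => W; apply/implyP => /and3P[sW cW W0].
  have sWV : W \subset V := subset_trans sW (subsetDl _ _).
  apply/negP => zW.
  have zW' := zero_matched (fpf_sub fa sWV cW) (matched_sub ma sWV) zW.
  have e := circuitP cw sWV W0 zW'.
  by have := subsetP sW x; rewrite e xV !inE eqxx => /(_ isT).
apply: (@le_trans _ _ (\sum_(a in Inv V) Pr E / n%:R ^+ M.+1)).
  apply: ler_sum => a aV; have fa := Inv_fpf aV.
  apply: peel_Pr => //.
    by apply: (fpf_sub fa); [apply: subsetDl|rewrite (closedD fa) ?sub_pair // (closed_pair fa)].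
  by move: cV; rewrite (card_fpf_pair fa xV) doubleS => -[].
rewrite sumr_const -[leLHS]mulr_natl [leRHS]mulrAC -[leRHS]mulrA ler_wpM2r //.
  by rewrite mulr_ge0 ?invr_ge0 ?exprn_ge0 ?ler0n ?Pr_ge0.
by rewrite ler_nat card_Inv.
Qed.

(** [(odd5 M / n^M) (3/n)] is the matching bound of the top level, by [dfact_cbound]; [weight M] and
    the other powers of [3 / n] account for the levels below. *)
Definition cbound M i : rat := (odd5 M)%:R / n%:R ^+ M * weight M * (3 / n%:R) ^+ i.+1.

Lemma cbound_ge0 M i : 0 <= cbound M i.
Proof.
have w0 : 0 <= weight M by apply: le_trans (weight_ge1 M).
by rewrite /cbound !mulr_ge0 ?invr_ge0 ?exprn_ge0 ?divr_ge0 ?ler0n.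
Qed.

Lemma dfact_cbound M : (dfact M.+2)%:R / n%:R ^+ M.+1 = (odd5 M)%:R / n%:R ^+ M * (3 / n%:R) :> rat.
Proof.
have n0 := lt0r_neq0 nR_gt0.
rewrite dfact_odd5 natrM exprS; have A0 : n%:R ^+ M != 0 :> rat by rewrite expf_neq0.
by field; rewrite A0 n0.
Qed.

(** Here [G U] stands for the probability that [U] and one further key form a circuit, which forces
    [#|U|] to be odd and at least 3. *)
Lemma circ_subsets_sum i S M (G : {set key} -> rat) : #|S| = (M.*2 + 3)%N ->
  (7 * M.+2 <= 2 * n)%N -> (forall U, U \subset S -> 0 <= G U) ->
  (forall U, U \subset S -> G U != 0 -> exists2 j, #|U| = (j.*2 + 3)%N & G U <= cbound j i) ->
  \sum_(U : {set key} | U \subset S) G U <= weight M * (3 / n%:R) ^+ i.+1.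
Proof.
move=> cS Mn G0 hG.
apply: (le_trans (subset_sum (h := fun j => cbound j i) cS _)).
  move=> U sU; case: (eqVneq (G U) 0) => [->|/(hG U sU)[j cU le]].
    by apply: sumr_ge0 => j _; rewrite mulr_ge0 ?ler0n ?cbound_ge0.
  have jM : (j < M.+1)%N.
    by have := subset_leq_card sU; rewrite cU cS leq_add2r leq_double.
  rewrite (bigD1 (Ordinal jM)) //= cU eqxx mul1r ler_wpDr //.
  by apply: sumr_ge0 => l _; rewrite mulr_ge0 ?ler0n ?cbound_ge0.
have -> : \sum_(j < M.+1) 'C(M.*2 + 3, j.*2 + 3)%:R * cbound j i =
    (\sum_(j < M.+1) bincoef M j * weight j / n%:R ^+ j) * (3 / n%:R) ^+ i.+1.
  rewrite mulr_suml; apply: eq_bigr => j _; rewrite /cbound /bincoef natrM.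
  by move: (_ ^- j) (_ ^+ i.+1) => A B; ring.
rewrite ler_wpM2r ?exprn_ge0 ?divr_ge0 ?ler0n //.
exact: circuit_sum n_ge256 Mn.
Qed.

Lemma low_circ i V : (i <= d)%N -> low i.+1 (circ i V).
Proof.
move=> id w w' ag; rewrite /circ /circuit -addnS.
rewrite (zero_agree c_gt0 ag) //; congr [&& _, _ & _]; apply: eq_forallb => W.
by rewrite (zero_agree c_gt0 ag).
Qed.

(** A circuit of level [i + 1] is dependent at level [i] too, hence contains a circuit of that level
    through a fixed key [x]. This is an event of lower tables, so the estimates of the levels
    multiply. *)
Lemma circ_prob i V M : (i <= d)%N -> (7 * M.+2 <= 2 * n)%N -> #|V| = M.+2.*2 ->
  Pr (circ i V) <= cbound M i.
Proof.
elim: i V M => [|i IH] V M id Mn cV.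
  apply: (le_trans (circ_step (E := predT) id _ _ cV)) => //.
  apply: (@le_trans _ _ ((dfact M.+2)%:R / n%:R ^+ M.+1)).
    by rewrite ler_piMr ?Pr_le1 // mulr_ge0 ?invr_ge0 ?exprn_ge0 ?ler0n.
  rewrite dfact_cbound /cbound expr1 -!mulrA ler_wpM2l ?ler0n // ler_wpM2l ?invr_ge0 ?exprn_ge0 ?ler0n //.
  by rewrite ler_peMl ?weight_ge1 // divr_ge0 ?ler0n.
have /card_gt0P[x xV] : (0 < #|V|)%N by rewrite cV.
pose E w := [exists U : {set key}, (U \subset V :\ x) && circ i (x |: U) w].
have lE : low i.+1 E.
  move=> w w' ag; apply: eq_existsb => U; congr andb.
  exact: low_circ (ltnW id) _ _ ag.
apply: (le_trans (circ_step id lE _ cV)).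
  move=> w /and3P[V0 zV _].
  have zV' : zero w.1 (c.-1 + i).+1 V by apply: zero_leq zV; rewrite addnS ltnW.
  have [|C [cC xC sC]] := circuit_through _ zV' xV; first by move=> A B; apply: zeroD.
  apply/existsP; exists (C :\ x); rewrite setD1K // /circ cC andbT.
  by rewrite setSD.
have -> : cbound M i.+1 = (dfact M.+2)%:R / n%:R ^+ M.+1 * (weight M * (3 / n%:R) ^+ i.+1).
  by rewrite dfact_cbound /cbound [in LHS]exprS; ring.
rewrite ler_wpM2l //; first by rewrite mulr_ge0 ?invr_ge0 ?exprn_ge0 ?ler0n.
apply: (le_trans (Pr_union (P := fun U : {set key} => U \subset V :\ x)
  (F := fun U => circ i (x |: U)) _)).
  by move=> w /existsP[U /andP[sU cU]]; exists U.
apply: circ_subsets_sum => //.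
- by move: cV; rewrite (cardsD1 x) xV add1n !doubleS => -[->]; rewrite addn3.
- by move=> U _; apply: Pr_ge0.
move=> U sU nz.
have xU : x \notin U by apply/negP => /(subsetP sU); rewrite !inE eqxx.
have [w cw|none] := pickP (circ i (x |: U)); last first.
  by rewrite Pr_eq0 ?eqxx // in nz => w; rewrite none.
have [j cj] := circ_card cw.
have cU : #|U| = (j.*2 + 3)%N by move: cj; rewrite cardsU1 xU add1n !doubleS => -[->]; rewrite addn3.
exists j => //; apply: IH => //; first exact: ltnW.
have := subset_leq_card sU; rewrite cU.
have : #|V :\ x| = (M.*2 + 3)%N by move: cV; rewrite (cardsD1 x) xV add1n !doubleS => -[->]; rewrite addn3.
move=> ->; rewrite leq_add2r leq_double => jM.
by apply: leq_trans Mn; rewrite leq_mul2l.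
Qed.

(* For [d >= 2] the last key of the path lies on a circuit of level [d - 2], whose
   other keys determine it. *)
Lemma last_key_prob i S M : (i <= d)%N -> #|S| = (M.*2 + 3)%N -> (7 * M.+2 <= 2 * n)%N ->
  \sum_(x : key | x \notin S)
    Pr (fun w => [exists U : {set key}, (U \subset S) && circ i (x |: U) w])
  <= weight M * (3 / n%:R) ^+ i.+1.
Proof.
move=> id cS Mn.
apply: (@le_trans _ _ (\sum_(x : key | x \notin S) \sum_(U : {set key} | U \subset S)
    Pr (circ i (x |: U)))).
  apply: ler_sum => x _; apply: Pr_union => w /existsP[U /andP[sU cU]]; by exists U.
rewrite exchange_big /=; apply: circ_subsets_sum => //.
  by move=> U _; apply: sumr_ge0 => x _; apply: Pr_ge0.
move=> U sU nz.
(* For given [U] only the xor of its keys can complete a circuit, so after exchanging the sums a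
   single [x] survives. *)
pose x0 : key := [ffun p => \big[@bxor k/bzero k]_(y in U) y p].
have only x : x \notin S -> x != x0 -> Pr (circ i (x |: U)) = 0.
  move=> xS xx0; apply: Pr_eq0 => w; apply: contra xx0 => cw; apply/eqP.
  have xU : x \notin U by apply: contra xS; apply: subsetP.
  by rewrite {1}(circ_last cw (setU11 _ _)) setU1K.
have [x0S|x0S] := boolP (x0 \in S).
  by move: nz; rewrite big1 ?eqxx // => x xS; apply: only => //; apply: contraNneq xS => ->.
move: nz; rewrite (bigD1 x0) //= big1 ?addr0; last by move=> x /andP[]; apply: only.
move=> nz; have xU : x0 \notin U by apply: contra x0S; apply: subsetP.
have [w cw|none] := pickP (circ i (x0 |: U)); last first.
  by rewrite Pr_eq0 ?eqxx // in nz => w; rewrite none.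
have [j cj] := circ_card cw.
have cU : #|U| = (j.*2 + 3)%N by move: cj; rewrite cardsU1 xU add1n !doubleS => -[->]; rewrite addn3.
exists j => //; apply: circ_prob => //.
have := subset_leq_card sU; rewrite cU cS leq_add2r leq_double => jM.
by apply: leq_trans Mn; rewrite leq_mul2l.
Qed.

End Circuits.

Local Close Scope ring_scope.

(** * Obstructions *)

Section Obstructions.
Variables (k r c d : nat).
Hypotheses (c_gt0 : 0 < c) (d_gt0 : 0 < d).
Local Notation Om := (tables k r c d).
Local Notation key := (key k c).
Variables (Q : {set key}) (f : key -> bits r -> {ffun qtype Q -> bits r} -> bool).
Hypothesis f_sel : selector f.
Local Notation ffk := {ffun key -> key}.
Implicit Types (x y : key) (S U V W Z : {set key}) (w : Om) (p q : key * ffk).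

(* A matching of [S] that misses the single key [p.1]. *)
Definition near S : {set key * ffk} := [set p | (p.1 \in S) && (p.2 \in Inv (S :\ p.1))].

Definition edges i S p w :=
  ind (zero w.1 (c.-1 + i)) p.2 (S :\ p.1) && matched w.1 i p.2 (S :\ p.1).

Definition free_selected S w :=
  (S \subset selected f w) && ((S \subset Q) || indk w (S :|: Q)).

(** The conjuncts follow the order of the tables: below level [d - 1], level [d - 1], level [d], and
    finally the tables that decide selection. *)
Definition obstruction (L : pred Om) S p q w :=
  [&& L w, edges d.-1 S p w, edges d S q w & free_selected S w].

(** For [d = 1] no level lies below that of the edges [p], and [x] is read off from a union of these
    edges together with its own partner [p.1]. *)
Definition last_key S p x : pred Om :=
  if d.-1 is d'.+1 then fun w => [exists U : {set key}, (U \subset S) && circ d' (x |: U) w]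
  else fun=> [exists W : {set key}, [&& W \subset S :\ p.1, eclosed p.2 W &
                x == [ffun j => \big[@bxor k/bzero k]_(y in p.1 |: W) y j]]].

Lemma ind_restr (P : pred {set key}) a V : ind P a V -> ind P (restr a V) V.
Proof.
move=> h; apply/forallP => W; apply/implyP => /and3P[sW cW W0]; apply: (indP h) => //.
by apply/forall_inP => x xW; rewrite -(restrE a (subsetP sW _ xW)); apply: closedP cW xW.
Qed.

Lemma matched_restr T i a V : matched (k := k) (c := c) (d := d) T i a V -> matched T i (restr a V) V.
Proof. by move=> h; apply/forall_inP => x xV; rewrite restrE // (matchedP h xV). Qed.

Lemma selected_dependent w :
  lin_dependent [set derived_key w x | x in selected f w] ->
  exists Z, [&& Z \subset selected f w, Z != set0 & zero w.1 (c + d) Z].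
Proof.
case/existsP => Y /and3P[Y0 sY /forallP ev].
have inj : injective (derived_key w).
  move=> x y /ffunP e; apply: (ch_inj c_gt0 (T := w.1)) => j jc.
  have jcd : j < c + d by rewrite ltn_addr.
  by have := e (Ordinal jcd); rewrite !derived_keyE.
exists [set x in selected f w | derived_key w x \in Y]; apply/and3P; split.
- by apply/subsetP => x; rewrite inE => /andP[].
- case/set0Pn: Y0 => u uY; have /imsetP[x xX e] := subsetP sY _ uY.
  by apply/set0Pn; exists x; rewrite inE xX -e.
apply/forallP => -[j b]; have /forallP/(_ b) := ev j.
rewrite /crow /= ltn_ord -odd_card_setI /=.
rewrite (_ : [set u in Y | u j == b] = derived_key w @:
  [set x in [set x in selected f w | derived_key w x \in Y] | ch w.1 x j == b]).
  by rewrite card_imset.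
apply/setP => u; rewrite inE; apply/andP/imsetP => [[uY /eqP ub]|[x + ->]].
  have /imsetP[x xX e] := subsetP sY _ uY.
  by exists x => //; rewrite !inE in xX *; rewrite xX -e uY -derived_keyE -e ub eqxx.
by rewrite !inE -derived_keyE => /andP[/andP[_ ->] ->].
Qed.

Lemma minimal_dependent w Z0 :
  [&& Z0 \subset selected f w, Z0 != set0 & zero w.1 (c + d) Z0] ->
  exists Z, [/\ [&& Z \subset selected f w, Z != set0 & zero w.1 (c + d) Z],
    (forall W, W \subset Z -> W != set0 -> zero w.1 (c + d) W -> W = Z) &
    (forall W, W \subset selected f w -> W != set0 -> zero w.1 (c + d) W ->
       #|Z :\: Q| <= #|W :\: Q|)].
Proof.
move=> PZ0; pose P Z := [&& Z \subset selected f w, Z != set0 & zero w.1 (c + d) Z].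
(* A lexicographic measure: the factor exceeds the size of any set of keys. *)
pose mes Z := #|Z :\: Q| * #|key|.+1 + #|Z|.
case: (@arg_minnP _ Z0 P mes PZ0) => Z PZ minZ; exists Z; split=> //.
  move=> W sW W0 zW; apply/eqP; rewrite eqEcard sW /=.
  have /and3P[sZ _ _] := PZ.
  have := minZ W; rewrite /P (subset_trans sW sZ) W0 zW => /(_ isT).
  have := subset_leq_card (setSD Q sW); rewrite /mes.
  move: #|Z :\: Q| #|W :\: Q| #|Z| #|W| #|key| => a b u v m; nia.
move=> W sW W0 zW; have := minZ W; rewrite /P sW W0 zW => /(_ isT).
have := max_card W; rewrite /mes.
move: #|Z :\: Q| #|W :\: Q| #|Z| #|W| #|key| => a b u v m; nia.
Qed.

(** * Alternating structures inside a minimal dependent set *)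

Section FromMinimal.
Variables (w : Om) (Z : {set key}) (alpha beta : ffk) (z : key).
Hypotheses (sZX : Z \subset selected f w)
  (minZ : forall W, W \subset Z -> W != set0 -> zero w.1 (c + d) W -> W = Z)
  (minQ : forall W, W \subset selected f w -> W != set0 -> zero w.1 (c + d) W ->
       #|Z :\: Q| <= #|W :\: Q|)
  (fa : fpf Z alpha) (ma : matched w.1 d.-1 alpha Z)
  (fb : fpf Z beta) (mb : matched w.1 d beta Z)
  (zZ : z \in Z) (zQ : (Z \subset Q) || (z \notin Q)).

Lemma top_level : (c.-1 + d).+1 = c + d.
Proof. by rewrite -addSn prednK. Qed.

Lemma Q_selected : Q \subset selected f w.
Proof. by apply/subsetP => x xQ; rewrite inE f_sel. Qed.

Lemma good_obstruction S x y (L : pred Om) : good Z alpha beta z S x y ->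
  ind (zero w.1 (c.-1 + d.-1)) alpha (S :\: [set x; alpha x]) ->
  let p := (alpha x, restr alpha (S :\: [set x; alpha x])) in
  let q := (y, restr beta (S :\: [set x; y])) in
  [/\ p \in near (S :\ x), q \in near (S :\ x) &
      L w -> obstruction L (S :\ x) p q w].
Proof.
move=> /and5P[sS cS xS yS /and3P[xy cb zS]] iS p q.
have fS := fpf_sub fa sS cS; have [axS axx aax] := fpfP fS xS.
have ep : S :\ x :\ alpha x = S :\: [set x; alpha x] by rewrite setDDl.
have eq : S :\ x :\ y = S :\: [set x; y] by rewrite setDDl.
have sS1 : S :\: [set x; alpha x] \subset Z := subset_trans (subsetDl _ _) sS.
have sS2 : S :\: [set x; y] \subset Z := subset_trans (subsetDl _ _) sS.
have f1 : fpf (S :\: [set x; alpha x]) alpha.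
  by apply: (fpf_sub fa) => //; rewrite (closedD fS) ?sub_pair // (closed_pair fS).
have f2 : fpf (S :\: [set x; y]) beta by apply: (fpf_sub fb).
split.
- by rewrite inE /= ep restr_Inv // !inE axx axS.
- by rewrite inE /= eq restr_Inv // !inE eq_sym xy yS.
move=> Lw; apply/and4P; split=> //.
- by rewrite /edges /= ep ind_restr // matched_restr // (matched_sub ma).
- rewrite /edges /= eq matched_restr ?andbT; last exact: matched_sub mb sS2.
  apply: ind_restr; apply/forallP => W; apply/implyP => /and3P[sW cW W0].
  have sWZ := subset_trans sW sS2.
  (* Being matched at level [d], a dependent union of these edges is dependent at all positions,
     hence all of [Z] by minimality; but it misses [x]. *)
  apply/negP => zW; have := zero_matched (fpf_sub fb sWZ cW) (matched_sub mb sWZ) zW.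
  rewrite top_level => /(minZ sWZ W0) e.
  by have := subsetP sW x; rewrite e (subsetP sS) // !inE eqxx => /(_ isT).
have sS'Z : S :\ x \subset Z := subset_trans (subsetDl _ _) sS.
rewrite /free_selected (subset_trans sS'Z sZX) /=.
case/orP: zQ => [sZQ|zNQ]; first by rewrite (subset_trans sS'Z).
(* The non-query keys of a dependent [W] would lie in [Z] without [z], so there would be fewer of
   them than in [Z]. *)
apply/orP; right; apply/forallP => W; apply/implyP => /andP[sW W0]; apply/negP => zW.
have zS' : z \notin S :\ x.
  by apply/negP; rewrite !inE => /andP[+ zS2]; move: zS; rewrite zS2 /= => ->.
have sWX : W \subset selected f w.
  by apply: subset_trans sW _; rewrite subUset (subset_trans sS'Z sZX) Q_selected.
have := minQ sWX W0 zW; rewrite leqNgt => /negP[].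
apply: proper_card; apply/properP; split.
  apply/subsetP => u; rewrite !inE => /andP[uQ /(subsetP sW)].
  rewrite in_setU (negbTE uQ) orbF => /(subsetP sS'Z) ->; by [].
exists z; first by rewrite inE zNQ.
rewrite inE zNQ /=; apply/negP => /(subsetP sW); rewrite in_setU (negbTE zNQ) orbF.
exact/negP.
Qed.

Lemma zero_pred_level V : V \subset Z -> eclosed alpha V -> zero w.1 (c.-1 + d.-1) V ->
  zero w.1 (c.-1 + d.-1).+1 V.
Proof.
move=> sV cV; apply: (zero_matched (a := alpha)); first exact: fpf_sub fa sV cV.
exact: matched_sub ma sV.
Qed.

(** In a smallest structure with dependent edges, one more step leaves independent edges. Hence
    every dependent union of edges uses the edge removed by that step, and so contains [x]. *)
Lemma minimal_good : ~~ ind (zero w.1 (c.-1 + d.-1)) alpha Z ->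
  exists S x y V, [/\ good Z alpha beta z S x y,
    ind (zero w.1 (c.-1 + d.-1)) alpha (S :\: [set x; alpha x]), 2 < #|S| &
    [/\ V \subset S, eclosed alpha V, x \in V & zero w.1 (c.-1 + d.-1) V]].
Proof.
move=> dZ.
pose P (s : {set key} * key * key) := good Z alpha beta z s.1.1 s.1.2 s.2 &&
  ~~ ind (zero w.1 (c.-1 + d.-1)) alpha s.1.1.
have P0 : P (Z, z, beta z) by rewrite /P good_start.
case: (@arg_minnP _ _ P (fun s => #|s.1.1|) P0) => -[[S x] y] /andP[/= g dS] minS.
have /and5P[sS cS xS _ _] := g.
move: (dS); rewrite negb_forall => /existsP[V]; rewrite negb_imply negbK.
move=> /andP[/and3P[sV cV V0] zV].
have fS := fpf_sub fa sS cS.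
(* [good_step] applies because a dependent set has at least four keys. *)
have S2 : 2 < #|S|.
  have cl : c <= (c.-1 + d.-1).+1 by rewrite -addSn prednK // leq_addr.
  have [v cardV v2] := zero_card c_gt0 cl (zero_pred_level (subset_trans sV sS) cV zV) V0.
  apply: leq_trans (subset_leq_card sV); rewrite cardV.
  by apply: (@leq_trans 2.*2); rewrite ?leq_double.
have iS : ind (zero w.1 (c.-1 + d.-1)) alpha (S :\: [set x; alpha x]).
  apply: contraT => dS0; have [x' [y' g']] := good_step fa fb g S2.
  have := minS (S :\: [set x; alpha x], x', y'); rewrite /P /= g' dS0 => /(_ isT).
  by rewrite (card_fpf_pair fS xS) => /ltnW; rewrite ltnn.
exists S, x, y, V; split=> //; split=> //.
apply: contraT => xV; have := indP iS _ cV V0; rewrite zV; apply=> //.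
apply/subsetP => u uV; rewrite !inE (subsetP sV) // andbT negb_or.
apply/andP; split; first by apply: contraNneq xV => <-.
apply: contraNneq xV => e; have := closedP cV uV; rewrite e.
by have [_ _ ->] := fpfP fS xS.
Qed.

Lemma last_keyP S x y V : good Z alpha beta z S x y -> V \subset S -> eclosed alpha V ->
  x \in V -> zero w.1 (c.-1 + d.-1) V ->
  last_key (S :\ x) (alpha x, restr alpha (S :\: [set x; alpha x])) x w.
Proof.
move=> /and5P[sS cS xS _ _] sV cV xV zV.
have zV' := zero_pred_level (subset_trans sV sS) cV zV.
have fS := fpf_sub fa sS cS; have fV := fpf_sub fS sV cV.
rewrite /last_key; move: zV zV'; case: (d.-1) => [|d'] zV zV'; rewrite ?addnS in zV zV'.
- apply/existsP; exists (V :\: [set x; alpha x]).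
  have sW : V :\: [set x; alpha x] \subset S :\: [set x; alpha x] by rewrite setSD.
  rewrite setDDl sW /=; apply/andP; split.
    apply/forall_inP => u uW; rewrite restrE ?(subsetP sW) //.
    by apply: closedP uW; rewrite (closedD fV) ?sub_pair // (closed_pair fV).
  have cl : c <= (c.-1 + 0).+1 by rewrite addn0 prednK.
  apply/eqP; rewrite {1}(zero_last c_gt0 cl zV' xV); apply/ffunP => j; rewrite !ffunE.
  apply: eq_bigl => u; rewrite !inE; have [axV axx _] := fpfP fV xV.
  by case: (eqVneq u (alpha x)) => [->|] /=; rewrite ?axx ?axV // orbF.
have [|C [cC xC sC]] := circuit_through _ zV xV; first by move=> A B; apply: zeroD.
apply/existsP; exists (C :\ x); rewrite setD1K // /circ cC andbT setSD //.
exact: subset_trans sC sV.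
Qed.

End FromMinimal.

(** A structure cut to [W + 2] edges keeps its independent edges but may lose the dependent set
    through its end. Its end is therefore not counted, and the event of the lower levels is weakened
    to [predT]. *)
Lemma dependent_obstruction w (W : nat) :
  lin_dependent [set derived_key w x | x in selected f w] ->
  (exists M S p q x, [/\ M < W, #|S| = M.*2 + 3, p \in near S, q \in near S &
     (x \notin S) && obstruction (last_key S p x) S p q w]) \/
  (exists S p q, [/\ #|S| = W.*2 + 3, p \in near S, q \in near S & obstruction predT S p q w]).
Proof.
move=> /selected_dependent[Z0 /minimal_dependent[Z [/and3P[sZ nZ zeroZ] minZ minQ]]].
have [z zZ zQ] : exists2 z, z \in Z & (Z \subset Q) || (z \notin Q).
  have [sZQ|] := boolP (Z \subset Q); last by case/subsetPn => z zZ zQ; exists z.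
  by case/set0Pn: nZ => z zZ; exists z.
have z1 : zero w.1 (c.-1 + d.-1).+1 Z.
  by apply: zero_leq zeroZ; rewrite -addSn prednK // leq_add2l leq_pred.
have [alpha aZ ma] := zero_matching c_gt0 (leq_pred d) z1.
have [|beta bZ mb] := @zero_matching k c d c_gt0 w.1 d Z (leqnn d).
  by rewrite top_level.
have fa := Inv_fpf aZ; have fb := Inv_fpf bZ.
have [|S [x [y [V [g iS S2 [sV cV xV zV]]]]]] := minimal_good fa ma fb zZ.
  apply/negP => iZ; have := indP iZ (subxx _) (fpf_closed fa) nZ.
  by rewrite (zero_leq _ z1) // ltnW.
have cardS := card_good fa g; move: cardS; set h := #|halfset _ _| => cardS.
have h2 : 2 <= h by move: S2; rewrite cardS; clearbody h; clear; lia.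
case: (ltnP h.-2 W) => hW.
  left; exists h.-2, (S :\ x).
  have [pn qn ob] := good_obstruction sZ minZ minQ fa ma fb mb zZ zQ (last_key (S :\ x)
    (alpha x, restr alpha (S :\: [set x; alpha x])) x) g iS.
  do 2!eexists; exists x; split; [by []| |exact: pn|exact: qn|].
    have /and5P[_ _ xS _ _] := g.
    by move: cardS; rewrite (cardsD1 x) xS; clearbody h; move: h2; clear; move: #|_| => m; lia.
  by rewrite !inE eqxx ob //; apply: (last_keyP fa ma g sV cV xV zV).
right.
have le : W.+2.*2 <= #|S| by rewrite cardS leq_double; clearbody h; move: h2 hW; clear; lia.
have [S' [x' [y' [g' c' s']]]] := good_descend fa fb g (ltn0Sn _) le.
have [pn qn ob] := good_obstruction sZ minZ minQ fa ma fb mb zZ zQ predT g' (ind_sub iS s').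
exists (S' :\ x'); do 2!eexists; split; [|exact: pn|exact: qn|exact: ob].
have /and5P[_ _ xS _ _] := g'.
by move: c'; rewrite (cardsD1 x') xS; clear; move: #|_| => m; lia.
Qed.

End Obstructions.

(** * The union bound *)

Local Open Scope ring_scope.

(** Each [N]-element set occurs in [N!] orders in the expansion of the power. *)
Lemma sum_sets_prod (K : finType) (g : K -> rat) N : (forall x, 0 <= g x) ->
  (\sum_(S : {set K} | #|S| == N) \prod_(x in S) g x) * N`!%:R <= (\sum_x g x) ^+ N.
Proof.
move=> g0; have P0 (S : {set K}) : 0 <= \prod_(x in S) g x by apply: prodr_ge0.
elim: N => [|N IH].
  rewrite (eq_bigl (pred1 set0)) => [|S]; last by rewrite cards_eq0.
  by rewrite big_pred1_eq big_set0 fact0 mulr1 expr0.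
have step : (\sum_(S : {set K} | #|S| == N.+1) \prod_(x in S) g x) * N.+1%:R
    <= (\sum_(S : {set K} | #|S| == N) \prod_(x in S) g x) * \sum_x g x.
  have -> : (\sum_(S : {set K} | #|S| == N.+1) \prod_(x in S) g x) * N.+1%:R =
      \sum_(S : {set K} | #|S| == N.+1) \sum_(x in S) g x * \prod_(y in S :\ x) g y.
    rewrite mulr_suml; apply: eq_bigr => S /eqP cS.
    rewrite [RHS](eq_bigr (fun=> \prod_(x in S) g x)) => [|x xS]; last by rewrite [RHS](big_setD1 x xS).
    by rewrite sumr_const cS mulr_natr.
  rewrite (exchange_big_dep predT) //= mulrC mulr_suml; apply: ler_sum => x _.
  rewrite -mulr_sumr ler_wpM2l //.
  rewrite (reindex_onto (fun S => x |: S) (fun S => S :\ x)) /=; last first.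
    by move=> S /andP[_ xS]; rewrite setD1K.
  rewrite big_mkcond [leRHS]big_mkcond; apply: ler_sum => S _ /=.
  case: (boolP (x \in S)) => xS.
    have -> : (x |: S) :\ x == S = false by apply/eqP => e; move: xS; rewrite -e !inE eqxx.
    by rewrite andbF; case: ifP.
  by rewrite cardsU1 xS setU1K // setU11 eqxx !andbT eqSS.
rewrite factS natrM mulrA exprSr.
apply: (@le_trans _ _ ((\sum_(S : {set K} | #|S| == N) \prod_(x in S) g x) * (\sum_x g x) * N`!%:R)).
  by rewrite ler_wpM2r ?ler0n.
by rewrite mulrAC ler_wpM2r // sumr_ge0.
Qed.

(** With [n = 256 m], the exponent [146 m - 2] of 2 on the right leaves [18 m - 2] beyond [128 m];
    each polynomial factor costs at most [m + 6]. *)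
Lemma truncation_nat m : (0 < m)%N ->
  ((73 * m) * (128 * m) * 2 ^ (128 * m) <= 4 ^ (73 * m - 1))%N.
Proof.
move=> m0; have m2 : (m <= 2 ^ m.-1)%N by have := ltn_expl m.-1 (ltnSn 1); rewrite prednK.
have h73 : (73 * m <= 2 ^ (7 + m.-1))%N by rewrite expnD leq_mul.
have h128 : (128 * m <= 2 ^ (7 + m.-1))%N by rewrite expnD leq_mul.
rewrite -[4%N]/(2 ^ 2)%N -expnM.
have -> : (2 * (73 * m - 1) = (7 + m.-1) + (7 + m.-1) + 128 * m + (16 * m - 14))%N by lia.
move: (73 * m)%N (128 * m)%N (7 + m.-1)%N (16 * m - 14)%N h73 h128 => a t u v ha ht.
rewrite !expnD; apply: (@leq_trans (2 ^ u * 2 ^ u * 2 ^ t)%N); first by rewrite !leq_mul.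
by rewrite leq_pmulr // expn_gt0.
Qed.

Lemma Pr_exists (T I : finType) (P : pred I) (F : I -> pred T) :
  Pr (fun w => [exists i, P i && F i w]) <= \sum_(i | P i) Pr (F i).
Proof. by apply: Pr_union => w /existsP[i /andP[Pi Fi]]; exists i. Qed.

Section Summation.
Variables (k r c d : nat).
Hypotheses (k_ge8 : (8 <= k)%N) (c_gt0 : (0 < c)%N) (d_gt0 : (0 < d)%N).
Local Notation Om := (tables k r c d).
Local Notation key := (key k c).
Local Notation n := #|{: bits k}|.
Variables (Q : {set key}) (f : key -> bits r -> {ffun qtype Q -> bits r} -> bool).
Hypothesis f_sel : selector f.
Local Notation ffk := {ffun key -> key}.
Implicit Types (x y : key) (S U V : {set key}) (w : Om) (p q : key * ffk).
Local Notation prodp S := (\prod_(x in S) pf f x).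

Lemma prodp_ge0 S : 0 <= prodp S.
Proof. by apply: prodr_ge0 => x _; apply: pf_ge0. Qed.

Lemma muf_ge0 : 0 <= muf f.
Proof. by apply: sumr_ge0 => x _; apply: pf_ge0. Qed.

Lemma card_near S M : #|S| = (M.*2 + 3)%N -> (#|near S| <= dfact M.+2)%N.
Proof.
move=> cS.
have -> : #|near S| = (\sum_(u in S) \sum_(A in Inv (S :\ u)) 1)%N.
  by rewrite pair_big_dep -sum1_card; apply: eq_bigl => p; rewrite inE.
apply: (@leq_trans (\sum_(u in S) dfact M.+1)%N).
  apply: leq_sum => u uS; rewrite sum1_card; apply: card_Inv.
  by move: cS; rewrite (cardsD1 u) uS; clear; move: #|_| => m; lia.
rewrite sum_nat_const cS (dfactS M.+1) mulnC leq_mul2l; apply/orP; right; lia.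
Qed.

Lemma low_edges i j S p : (i < j)%N -> (j <= d.+1)%N -> low j (edges i S p : pred Om).
Proof.
move=> ij jd w w' ag; have ag' : agree i w.1 w'.1 by move=> l li; apply: ag; apply: ltn_trans ij.
have id : (i <= d.+1)%N by rewrite (leq_trans (ltnW ij)).
rewrite /edges; congr andb.
  by apply: eq_forallb => W; rewrite (zero_agree c_gt0 ag').
apply: eq_forallb => x.
by rewrite !(ch_agree c_gt0 _ ag) // ltn_add2l.
Qed.

Lemma low_weaken i j (E : pred Om) : (i <= j)%N -> low i E -> low j E.
Proof. by move=> ij lE w w' ag; apply: lE => l li; apply: ag; apply: leq_trans ij. Qed.

Lemma lowI i (E F : pred Om) : low i E -> low i F -> low i (fun w => E w && F w).
Proof. by move=> lE lF w w' ag; rewrite (lE _ _ ag) (lF _ _ ag). Qed.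

(** Tables are peeled from the top: selection gives [prodp S], then levels [d] and [d - 1] give
    [n^-(M+1)] each, and [L] remains. *)
Lemma obstruction_prob (L : pred Om) S p q M : low d.-1 L -> #|S| = (M.*2 + 3)%N ->
  p \in near S -> q \in near S ->
  Pr (obstruction f L S p q) <= prodp S * (Pr L / n%:R ^+ M.+1 / n%:R ^+ M.+1).
Proof.
move=> lL cS; rewrite [p \in _]inE [q \in _]inE => /andP[pS pI] /andP[qS qI].
have card1 u : u \in S -> #|S :\ u| = M.+1.*2.
  by move=> uS; move: cS; rewrite (cardsD1 u) uS; clear; move: #|_| => m; lia.
have n0 : 0 < n%:R ^+ M.+1 :> rat by rewrite exprn_gt0 // nR_gt0.
pose E2 w := L w && edges d.-1 S p w.
pose E1 w := E2 w && edges d S q w.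
have lE2 : low d E2.
  apply: lowI; first by apply: low_weaken lL; apply: leq_pred.
  by apply: low_edges; rewrite ?prednK.
have lE1 : low d.+1 E1 by apply: lowI; [apply: low_weaken lE2|apply: low_edges].
apply: (@le_trans _ _ (prodp S * Pr E1)).
  have lE1' w w' : w.1 = w'.1 -> E1 w = E1 w' by move=> e; apply: lE1 => l _; rewrite e.
  rewrite /Pr mulrA ler_wpM2r ?invr_ge0 ?ler0n //.
  apply: le_trans (peel_keys f_sel S lE1').
  rewrite ler_nat; apply: subset_leq_card; apply/subsetP => w; rewrite !inE /E1 /E2.
  by move=> /and4P[-> -> -> /andP[-> ->]].
rewrite ler_wpM2l ?prodp_ge0 //.
apply: (@le_trans _ _ (Pr E2 / n%:R ^+ M.+1)).
  have H := peel_Pr k_ge8 c_gt0 (leqnn d) lE2 (Inv_fpf qI) (card1 _ qS).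
  by apply: le_trans H; apply: Pr_mono.
rewrite ler_wpM2r ?invr_ge0 ?(ltW n0) //.
have H := peel_Pr k_ge8 c_gt0 (leq_pred d) lL (Inv_fpf pI) (card1 _ pS).
by apply: le_trans H; apply: Pr_mono.
Qed.

Lemma low_last_key S p x : low d.-1 (last_key S p x : pred Om).
Proof.
rewrite /last_key; case: (d.-1) (leq_pred d) => [|d'] d'd w w' ag; first exact: erefl.
apply: eq_existsb => U; congr andb; exact: (low_circ c_gt0 _ (ltnW d'd) ag).
Qed.

Lemma last_key_sum S p M : #|S| = (M.*2 + 3)%N -> (7 * M.+2 <= 2 * n)%N -> p \in near S ->
  \sum_(x | x \notin S) Pr (last_key S p x : pred Om) <= 4 * (16 / 5) ^+ M * (3 / n%:R) ^+ d.-1.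
Proof.
move=> cS Mn; rewrite inE => /andP[pS pI].
rewrite /last_key; case E : d.-1 => [|d'].
  rewrite expr0 mulr1.
  (* For [d = 1] the event does not depend on the tables. Each closed set names one key, so counting
     closed sets gives [2^(M+1)]. *)
  pose WW := [set W : {set key} | (W \subset S :\ p.1) && eclosed p.2 W].
  apply: (@le_trans _ _ (\sum_(x : key) \sum_(W in WW)
    (x == [ffun j => \big[@bxor k/bzero k]_(y in p.1 |: W) y j])%:R)).
    rewrite big_mkcond; apply: ler_sum => x _; case: ifP => _; last first.
      by apply: sumr_ge0 => W _; rewrite ler0n.
    have [/existsP[W /and3P[sW cW xE]]|nex] := boolP [exists W : {set key},
        [&& W \subset S :\ p.1, eclosed p.2 W &
            x == [ffun j => \big[@bxor k/bzero k]_(y in p.1 |: W) y j]]].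
      apply: le_trans (Pr_le1 _) _; rewrite (bigD1 W) /=; last by rewrite inE sW cW.
      by rewrite xE ler_wpDr // sumr_ge0 // => W' _; rewrite ler0n.
    rewrite Pr_eq0 //.
    by apply: sumr_ge0 => W _; rewrite ler0n.
  rewrite exchange_big /= (eq_bigr (fun=> 1)) => [|W _]; last first.
    set x0 := [ffun _ => _]; rewrite (bigD1 x0) //= eqxx big1 ?addr0 //.
    by move=> x /negPf ->.
  rewrite sumr_const.
  apply: (@le_trans _ _ (2 ^ M.+1)%N%:R).
    rewrite ler_nat; apply: leq_trans (card_closed (Inv_fpf pI)) _.
    rewrite leq_exp2l //; have := card_half (Inv_fpf pI).
    have : #|S :\ p.1| = M.+1.*2 by move: cS; rewrite (cardsD1 p.1) pS; clear; move: #|_| => m; lia.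
    by move=> -> /double_inj ->.
  rewrite natrX exprS; have : (2 : rat) ^+ M <= (16 / 5) ^+ M by apply: lerXn2r; rewrite ?nnegrE; lra.
  have : 0 <= (2 : rat) ^+ M by apply: exprn_ge0.
  lra.
have d'd : (d' <= d)%N by rewrite -ltnS -E; apply: leq_trans (leq_pred d) _.
apply: le_trans (@last_key_prob k r c d k_ge8 c_gt0 d' S M d'd cS Mn) _.
by rewrite ler_wpM2r ?exprn_ge0 ?divr_ge0 ?ler0n // weight_le4.
Qed.

Definition main_event M w := [exists S : {set key}, (#|S| == (M.*2 + 3)%N) &&
  [exists p, (p \in near S) && [exists q, (q \in near S) &&
    [exists x, (x \notin S) && obstruction f (last_key S p x) S p q w]]]].

Definition long_event M w := [exists S : {set key}, (#|S| == (M.*2 + 3)%N) &&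
  [exists p, (p \in near S) && [exists q, (q \in near S) && obstruction f predT S p q w]]].

Lemma structure_sum M (F : {set key} -> key * ffk -> key * ffk -> rat) (G : rat) : 0 <= G ->
  (forall S p q, #|S| = (M.*2 + 3)%N -> p \in near S -> q \in near S ->
     F S p q <= prodp S * (G / n%:R ^+ M.+1 / n%:R ^+ M.+1)) ->
  \sum_(S : {set key} | #|S| == (M.*2 + 3)%N) \sum_(p in near S) \sum_(q in near S) F S p q
  <= paths M * G * (muf f / n%:R) ^+ M.*2 * (muf f ^+ 3 / n%:R ^+ 2).
Proof.
move=> G0 leF; have n0 := nR_gt0 k_ge8.
set B := G / n%:R ^+ M.+1 / n%:R ^+ M.+1.
have B0 : 0 <= B by rewrite /B !divr_ge0 // exprn_ge0 // ltW.
apply: (@le_trans _ _ (\sum_(S : {set key} | #|S| == (M.*2 + 3)%N)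
    prodp S * B * (dfact M.+2)%:R ^+ 2)).
  apply: ler_sum => S /eqP cS.
  apply: (@le_trans _ _ (\sum_(p in near S) \sum_(q in near S) prodp S * B)).
    by apply: ler_sum => p pS; apply: ler_sum => q qS; apply: leF.
  rewrite !sumr_const -mulrnA -[leLHS]mulr_natr.
  apply: ler_wpM2l; first by rewrite mulr_ge0 ?prodp_ge0.
  by rewrite expr2 -natrM ler_nat leq_mul // card_near.
have := sum_sets_prod (M.*2 + 3) (pf_ge0 f).
rewrite -/(muf f) -!mulr_suml; set e := \sum_(_ | _) _ => le_e.
have fact0 : 0 < ((M.*2 + 3)`!)%:R :> rat by rewrite ltr0n fact_gt0.
rewrite -ler_pdivlMr // in le_e.
rewrite -[e * B * _]mulrA.
apply: le_trans (ler_wpM2r _ le_e) _; first by rewrite mulr_ge0 ?exprn_ge0 ?ler0n.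
have A0 : n%:R ^+ M != 0 :> rat by rewrite expf_neq0 // lt0r_neq0.
rewrite le_eqVlt; apply/orP; left; apply/eqP.
have double_exp (u : rat) : u ^+ M.*2 = u ^+ M * u ^+ M by rewrite -addnn exprD.
rewrite /B /paths expr_div_n (exprD _ M.*2 3) !double_exp (exprS n%:R M).
move: (lt0r_neq0 fact0) (lt0r_neq0 n0) A0.
move: (_`!%:R) (muf f ^+ M) (n%:R ^+ M : rat) (n%:R : rat) (_%:R ^+ 2) => a b u v e2 a0 v0 u0.
by field; rewrite a0 v0 u0.
Qed.

Lemma main_prob M : (7 * M.+2 <= 2 * n)%N ->
  Pr (main_event M) <= paths M * (4 * (16 / 5) ^+ M * (3 / n%:R) ^+ d.-1)
    * (muf f / n%:R) ^+ M.*2 * (muf f ^+ 3 / n%:R ^+ 2).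
Proof.
move=> Mn.
have n0 : 0 < n%:R ^+ M.+1 :> rat by rewrite exprn_gt0 // nR_gt0.
have G0 : 0 <= 4 * (16 / 5) ^+ M * (3 / n%:R) ^+ d.-1 :> rat.
  by rewrite !mulr_ge0 ?exprn_ge0 ?divr_ge0 ?ler0n.
apply: le_trans (structure_sum (F := fun S p q => \sum_(x | x \notin S)
    Pr (obstruction f (last_key S p x) S p q)) G0 _).
  apply: le_trans (Pr_exists _ _) _; apply: ler_sum => S _.
  apply: le_trans (Pr_exists _ _) _; apply: ler_sum => p _.
  by apply: le_trans (Pr_exists _ _) _; apply: ler_sum => q _; apply: Pr_exists.
move=> S p q cS pS qS.
apply: (@le_trans _ _ (\sum_(x | x \notin S)
    prodp S * (Pr (last_key S p x : pred Om) / n%:R ^+ M.+1 / n%:R ^+ M.+1))).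
  by apply: ler_sum => x _; apply: obstruction_prob => //; apply: low_last_key.
rewrite -mulr_sumr -2!mulr_suml; apply: ler_wpM2l; first exact: prodp_ge0.
do 2!(apply: ler_wpM2r; first by rewrite invr_ge0 ltW).
exact: last_key_sum.
Qed.

Lemma long_prob M :
  Pr (long_event M) <= paths M * 1 * (muf f / n%:R) ^+ M.*2 * (muf f ^+ 3 / n%:R ^+ 2).
Proof.
have n0 : 0 < n%:R ^+ M.+1 :> rat by rewrite exprn_gt0 // nR_gt0.
apply: le_trans (structure_sum (F := fun S p q => Pr (obstruction f predT S p q)) ler01 _).
  apply: le_trans (Pr_exists _ _) _; apply: ler_sum => S _.
  by apply: le_trans (Pr_exists _ _) _; apply: ler_sum => p _; apply: Pr_exists.
move=> S p q cS pS qS.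
apply: le_trans (obstruction_prob (L := predT) _ cS pS qS) _ => //.
by rewrite ler_wpM2l ?prodp_ge0 // !ler_wpM2r ?invr_ge0 ?(ltW n0) // Pr_le1.
Qed.

Lemma dependence_prob (W : nat) :
  Pr (fun w : Om => lin_dependent [set derived_key w x | x in selected f w])
  <= \sum_(M < W) Pr (main_event M) + Pr (long_event W).
Proof.
apply: (@le_trans _ _ (Pr (fun w => [exists M : 'I_W, main_event M w]) + Pr (long_event W))).
  rewrite -mulrDl ler_wpM2r ?invr_ge0 ?ler0n // -natrD ler_nat.
  apply: leq_trans (leq_card_setU _ _); apply: subset_leq_card; apply/subsetP => w.
  rewrite !inE => /(dependent_obstruction c_gt0 d_gt0 f_sel W).
  case=> [[M [S [p [q [x [MW cS pS qS ob]]]]]]|[S [p [q [cS pS qS ob]]]]]; apply/orP.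
    left; apply/existsP; exists (Ordinal MW); apply/existsP; exists S; rewrite cS eqxx.
    apply/existsP; exists p; rewrite pS; apply/existsP; exists q; rewrite qS.
    by apply/existsP; exists x.
  right; apply/existsP; exists S; rewrite cS eqxx.
  by apply/existsP; exists p; rewrite pS; apply/existsP; exists q; rewrite qS.
rewrite lerD2r; apply: le_trans (Pr_union (P := predT) (F := fun M : 'I_W => main_event M) _) _.
  by move=> w /existsP[M h]; exists M.
by [].
Qed.

Hypothesis mu_le : muf f <= n%:R / 2.

Lemma square_le : 0 <= (muf f / n%:R) ^+ 2 /\ (muf f / n%:R) ^+ 2 <= 1 / 4.
Proof.
have n0 := nR_gt0 k_ge8; have u0 : 0 <= muf f / n%:R by rewrite divr_ge0 ?muf_ge0 // ltW.
have u1 : muf f / n%:R <= 1 / 2 by rewrite ler_pdivrMr // mulrC mulrA mulr1.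
split; first exact: exprn_ge0.
have := ler_pM u0 u0 u1 u1; rewrite -expr2; lra.
Qed.

Lemma main_sum W : (7 * W.+1 <= 2 * n)%N ->
  \sum_(M < W) Pr (main_event M) <= 7 * muf f ^+ 3 * (3 / n%:R) ^+ d.+1.
Proof.
move=> Wn; have [x0 x4] := square_le; have n0 := nR_gt0 k_ge8.
apply: (@le_trans _ _ (\sum_(M < W) paths M * (4 * (16 / 5) ^+ M) * ((muf f / n%:R) ^+ 2) ^+ M
    * ((3 / n%:R) ^+ d.-1 * (muf f ^+ 3 / n%:R ^+ 2)))).
  apply: ler_sum => M _; apply: le_trans (main_prob _) _.
    by apply: leq_trans Wn; rewrite leq_mul2l /= ltnS ltn_ord.
  rewrite -mul2n exprM le_eqVlt; apply/orP; left; apply/eqP.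
  move: (((muf f / n%:R) ^+ 2) ^+ M) ((3 / n%:R : rat) ^+ d.-1) ((16 / 5 : rat) ^+ M) => a b e.
  by move: (paths M) (muf f ^+ 3 / _) => g h; ring.
rewrite -mulr_suml.
have F0 : 0 <= (3 / n%:R) ^+ d.-1 * (muf f ^+ 3 / n%:R ^+ 2).
  by rewrite mulr_ge0 ?exprn_ge0 ?divr_ge0 ?exprn_ge0 ?muf_ge0 ?ler0n.
apply: le_trans (ler_wpM2r F0 (path_sum W x0 x4)) _.
rewrite -[in leRHS](prednK d_gt0) !exprS.
(* [63 / n^2 = 7 * (3 / n)^2] supplies the two powers missing from [d - 1]. *)
rewrite le_eqVlt; apply/orP; left; apply/eqP.
by move: (_ ^+ d.-1) => u; field; rewrite lt0r_neq0.
Qed.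

Lemma long_sum m : (0 < m)%N -> n = (256 * m)%N ->
  Pr (long_event (73 * m - 2)) <= 1 / (2 ^ (128 * m))%N%:R.
Proof.
move=> m0 nm; set W := (73 * m - 2)%N; have [x0 x4] := square_le; have n0 := nR_gt0 k_ge8.
have W1 : W.+1 = (73 * m - 1)%N by rewrite /W; lia.
apply: le_trans (long_prob W) _.
(* Two of the spare factors [mu] and the [n^2] join the power, raising it to [W + 1]; one [mu] is
   left over. *)
have -> : paths W * 1 * (muf f / n%:R) ^+ W.*2 * (muf f ^+ 3 / n%:R ^+ 2) =
    paths W * ((muf f / n%:R) ^+ 2) ^+ W.+1 * muf f.
  rewrite -mul2n exprM (exprSr _ W); move: (_ ^+ W) (paths W) => a b; field.
  by rewrite lt0r_neq0.
have le1 : paths W <= (73 * m)%N%:R.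
  apply: le_trans (paths_linear W) _; rewrite -[2%R]/(2%:R) -natrD ler_nat /W; lia.
have le2 : ((muf f / n%:R) ^+ 2) ^+ W.+1 <= (1 / 4) ^+ W.+1 by apply: lerXn2r.
have le3 : muf f <= (128 * m)%N%:R.
  apply: le_trans mu_le _; rewrite nm (_ : 256 * m = 128 * m * 2)%N; last by lia.
  by rewrite natrM mulfK // pnatr_eq0.
have := ler_pM _ muf_ge0 (ler_pM (paths_ge0 W) _ le1 le2) le3.
have e0 : 0 <= ((muf f / n%:R) ^+ 2) ^+ W.+1 by apply: exprn_ge0.
move=> /(_ (mulr_ge0 (paths_ge0 W) e0) e0) le4.
apply: (le_trans le4).
rewrite expr_div_n expr1n mul1r ler_pdivlMr ?ltr0n ?expn_gt0 //.
have -> : (73 * m)%N%:R * 4 ^- W.+1 * (128 * m)%N%:R * (2 ^ (128 * m))%N%:R =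
    ((73 * m) * (128 * m) * 2 ^ (128 * m))%N%:R / 4 ^+ W.+1 :> rat.
  rewrite [in RHS]natrM [((73 * m) * (128 * m))%N%:R]natrM.
  by move: ((73 * m)%N%:R : rat) ((128 * m)%N%:R : rat) ((2 ^ _)%N%:R : rat) => x y z; ring.
rewrite ler_pdivrMr ?exprn_gt0 // mul1r W1 -natrX ler_nat.
exact: truncation_nat.
Qed.

End Summation.

Local Close Scope ring_scope.

Local Open Scope ring_scope.

Theorem theorem1p4 (k r c d : nat) (Q : {set key k c})
    (f : key k c -> bits r -> {ffun qtype Q -> bits r} -> bool) :
  (8 <= k)%N -> (1 <= c)%N -> (1 <= d)%N -> selector f ->
  muf f <= (#|{: bits k}|%:R / 2) ->
  Pr (fun w : tables k r c d =>
        lin_dependent [set derived_key w x | x in selected f w])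
  <= 7%:R * muf f ^+ 3 * (3%:R / #|{: bits k}|%:R) ^+ d.+1
     + 1 / (2 ^ (#|{: bits k}| %/ 2))%N%:R.
Proof.
move=> k8 c1 d1 f_sel mu_le.
set m := (2 ^ (k - 8))%N; have m0 : (0 < m)%N by rewrite expn_gt0.
have nm : #|{: bits k}| = (256 * m)%N.
  by rewrite card_bits -[256%N]/(2 ^ 8)%N -expnD subnKC.
(* Index [73 * m - 2] stands for [w = 73 m]. The recursion is used below this size, where
   [7 * (73 m - 1) <= 2 * 256 m]. *)
apply: le_trans (dependence_prob c1 d1 f_sel (73 * m - 2)) _; apply: lerD.
  by apply: main_sum => //; rewrite nm; lia.
have -> : (#|{: bits k}| %/ 2 = 128 * m)%N.
  by rewrite nm (_ : 256 * m = 128 * m * 2)%N ?mulnK //; lia.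
exact: long_sum.
Qed.
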